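(* Let $P_{Y|X}$ be a discrete memoryless channel (DMC) with finite input alphabet $\mathcal{X}$ and finite output alphabet $\mathcal{Y}$, with capacity $C>0$. Assume there exists a capacity-achieving input distribution $P_X^*$ with $\min_{x\in\mathcal{X}}P_X^*(x)>0$, and assume $B<\infty$. Fix any family $\{\rho_N\}_{N\in\mathbb{R}_+}$ of positive reals with $\lim_{N\to\infty}\rho_N=0$ and $\lim_{N\to\infty}\rho_N\sqrt{N}=\infty$. Then the optimal moderate deviations constant satisfies $$E^*=\frac{B}{C}.$$
   Context: $C=\max_{P_X}I(X;Y)$ (in nats), and $B=\max_{x,x'\in\mathcal{X}}D(P_{Y|X}(\cdot|x)\,\|\,P_{Y|X}(\cdot|x'))$, where $D$ is relative entropy. An $(M,N)$-variable-length feedback (VLF) code, with $M$ a positive integer and $N>0$ real, consists of: a message $W$ uniform on $\mathcal{W}=\{1,\dots,M\}$; encoders $f_n:\mathcal{W}\times\mathcal{Y}^{n-1}\to\mathcal{X}$, $n\ge1$, producing channel inputs $X_n=f_n(W,Y^{n-1})$, where the channel output $Y_n$ is distributed as $P_{Y|X}(\cdot|X_n)$ conditionally on $(W,X^n,Y^{n-1})$; decoders $g_n:\mathcal{Y}^n\to\mathcal{W}$; and a stopping time $\tau$ of the filtration $\{\sigma(Y^n)\}_{n\ge0}$ with $\mathbb{E}(\tau)\le N$. The decoded message is $\hat W=g_\tau(Y^\tau)$ and the average error probability is $\mathsf{P}_{\mathrm e}(R_N,N)=\mathbb{P}(\hat W\ne W)$, where $R_N=\frac1N\ln M_N$. A number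 $E\ge0$ is an achievable moderate deviations constant (for the given family $\{\rho_N\}$) if there is a family, indexed by $N\in\mathbb{R}_+$, of $(M_N,N)$-VLF codes with $M_N=\exp(NR_N)$, $R_N\ge C-\rho_N$, $\lim_{N\to\infty}\mathsf{P}_{\mathrm e}(R_N,N)=0$, and $\liminf_{N\to\infty}-\frac{\ln\mathsf{P}_{\mathrm e}(R_N,N)}{N\rho_N}\ge E$. The optimal moderate deviations constant $E^*$ is the supremum of all achievable moderate deviations constants. *)

(* Defs.v *)
(* classical reals. Alphabets are {0,...,nx-1} and {0,...,ny-1}. *)
From Stdlib Require Export Reals Lra List Arith Bool.
Export ListNotations.
Open Scope R_scope.
Open Scope bool_scope.

Definition sumR (n : nat) (f : nat -> R) : R :=
  fold_right Rplus 0 (map f (seq 0 n)).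

Definition sumL {A} (l : list A) (f : A -> R) : R :=
  fold_right Rplus 0 (map f l).

Fixpoint all_seqs (ny n : nat) : list (list nat) :=
  match n with
  | O => [ [] ]
  | S k => flat_map (fun s => map (fun y => s ++ [y]) (seq 0 ny)) (all_seqs ny k)
  end.

Definition is_channel (nx ny : nat) (W : nat -> nat -> R) : Prop :=
  (0 < nx)%nat /\ (0 < ny)%nat /\
  (forall x y, (x < nx)%nat -> (y < ny)%nat -> 0 <= W x y) /\
  (forall x, (x < nx)%nat -> sumR ny (fun y => W x y) = 1).

Definition is_dist (nx : nat) (P : nat -> R) : Prop :=
  (forall x, (x < nx)%nat -> 0 <= P x) /\ sumR nx P = 1.

Definition PY (nx : nat) (W : nat -> nat -> R) (P : nat -> R) (y : nat) : R :=
  sumR nx (fun x => P x * W x y).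

(* mutual information in nats, with 0 ln 0 = 0 convention *)
Definition mutual_info (nx ny : nat) (W : nat -> nat -> R) (P : nat -> R) : R :=
  sumR nx (fun x => sumR ny (fun y =>
    if Rlt_dec 0 (P x * W x y)
    then P x * W x y * ln (W x y / PY nx W P y) else 0)).

(* D(P(.|x) || P(.|x')) is finite iff supp P(.|x) is contained in supp P(.|x') *)
Definition rel_ent_finite (ny : nat) (W : nat -> nat -> R) (x x' : nat) : Prop :=
  forall y, (y < ny)%nat -> 0 < W x y -> 0 < W x' y.

(* value of D(P(.|x) || P(.|x')) when finite, 0 ln(0/q) = 0 convention *)
Definition rel_ent (ny : nat) (W : nat -> nat -> R) (x x' : nat) : R :=
  sumR ny (fun y => if Rlt_dec 0 (W x y) then W x y * ln (W x y / W x' y) else 0).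

(* stop rule: stop y = true iff the event {tau = length y} contains the
   output prefix y (checked at the first time it holds) *)
Definition stops_at (stop : list nat -> bool) (y : list nat) : bool :=
  stop y && forallb (fun k => negb (stop (firstn k y))) (seq 0 (length y)).

(* P(Y^n = y | W = w) under encoders f : time index n>=1 -> message -> past outputs -> input *)
Definition path_prob (W : nat -> nat -> R) (f : nat -> nat -> list nat -> nat)
  (w : nat) (y : list nat) : R :=
  fold_right Rmult 1
    (map (fun i => W (f (S i) w (firstn i y)) (nth i y 0%nat)) (seq 0 (length y))).

Definition p_tau (ny : nat) (W : nat -> nat -> R) (M : nat)
  (f : nat -> nat -> list nat -> nat) (stop : list nat -> bool) (n : nat) : R :=
  sumL (seq 1 M) (fun w => sumL (all_seqs ny n) (fun y =>
    if stops_at stop y then / INR M * path_prob W f w y else 0)).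

Definition p_err (ny : nat) (W : nat -> nat -> R) (M : nat)
  (f : nat -> nat -> list nat -> nat) (g : list nat -> nat) (stop : list nat -> bool)
  (n : nat) : R :=
  sumL (seq 1 M) (fun w => sumL (all_seqs ny n) (fun y =>
    if stops_at stop y && negb (Nat.eqb (g y) w)
    then / INR M * path_prob W f w y else 0)).

(* (M,N)-VLF code: messages {1..M}, encoders f, decoders g (g_n = g on length-n
   sequences), stopping time given by stop; E(tau) <= N (which forces tau < oo a.s.) *)
Definition is_VLF_code (nx ny : nat) (W : nat -> nat -> R) (M : nat) (N : R)
  (f : nat -> nat -> list nat -> nat) (g : list nat -> nat) (stop : list nat -> bool) : Prop :=
  (1 <= M)%nat /\
  (forall n w y, (f n w y < nx)%nat) /\
  (forall y, (1 <= g y <= M)%nat) /\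
  Un_cv (fun K => sum_f_R0 (p_tau ny W M f stop) K) 1 /\
  (forall K, sum_f_R0 (fun n => INR n * p_tau ny W M f stop n) K <= N).

Definition lim_infty (h : R -> R) (L : R) : Prop :=
  forall eps, 0 < eps -> exists N0, forall N, N >= N0 -> Rabs (h N - L) < eps.

Definition achievable_md (nx ny : nat) (W : nat -> nat -> R) (C : R) (rho : R -> R)
  (E : R) : Prop :=
  0 <= E /\
  exists (M : R -> nat) (f : R -> nat -> nat -> list nat -> nat)
         (g : R -> list nat -> nat) (stop : R -> list nat -> bool) (Pe : R -> R),
    (forall N, 0 < N ->
       is_VLF_code nx ny W (M N) N (f N) (g N) (stop N) /\
       Un_cv (fun K => sum_f_R0 (p_err ny W (M N) (f N) (g N) (stop N)) K) (Pe N) /\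
       ln (INR (M N)) / N >= C - rho N) /\
    lim_infty Pe 0 /\
    (* liminf -ln Pe / (N rho_N) >= E, with -ln 0 = +oo *)
    (forall eps, 0 < eps -> exists N0, forall N, N >= N0 ->
        Pe N <= exp (- ((E - eps) * (N * rho N)))).

(* Main.v *)
(* Converse: the posterior entropy of the message decreases in mean by at most C per step, and
   G = 1 - sum_w p_w^2 satisfies E ln G_n - E ln G_(n+1) <= B (for each w the drift splits into
   D(P||A) + D(P||R) <= p D(A||R) + (1-p) D(R||A), where P = p A + (1-p) R). Using the first
   bound until G falls below 1/N and the second one afterwards gives
   E tau >= ln M / C + ln (1/Pe) / B - O(ln N), and ln N = o(N rho_N).

   Achievability: for the potential U = sum_w p_w ln (p_w / (1 - p_w)), independent inputs drawn
   from the capacity-achieving law gain at least C on average, so some assignment of inputs to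
   messages gains at least C, whatever the posterior. It is used until a message has posterior
   at least 1 - 1/N; that message is then confirmed with the most distinguishable pair of inputs
   (gain at least (1 - e1) B) until its error probability is below exp (- E N rho_N). Falling
   back below 1 - e1 costs at most N steps and has probability O(1/N). *)
From Stdlib Require Import ZArith Lia Classical FunctionalExtensionality IndefiniteDescription.
Require Import Defs.

(** * Finite sums and Jensen inequalities *)

(** Functionals of the posterior are taken of the unnormalised vector [q], where [q w] is the joint
    probability of message [w] and the outputs so far, and are made homogeneous of degree one;
    [tot q] is the probability of the outputs. Conditional expectations then become plain sums over
    the next letter, with no division by a probability that may vanish. Finite divergences make each
    output letter either impossible under all inputs or of probability at least some [lam > 0] under
    all inputs. Hence [q] is zero or strictly positive throughout, and one step changes any odds by
    a bounded factor. This controls the overshoot of thresholds, the obstacle in joining two phases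
    with different drifts. G serves in the converse because one step multiplies [p_w (1 - p_w)] by
    exactly [A R / P^2], where A, R and P are the output probabilities given [w], given another
    message, and overall; the drift of its logarithm thus consists of divergences. In the direct
    part [E tau <= N] must hold for each [N], so the price of a fallback is built into the
    potential, in proportion to the posterior mass of the other messages, which is a martingale. *)

Lemma sumL_nil {A} (f : A -> R) : sumL [] f = 0.
Proof. reflexivity. Qed.

Lemma sumL_cons {A} (x : A) l f : sumL (x :: l) f = f x + sumL l f.
Proof. reflexivity. Qed.

Lemma sumL_app {A} (l1 l2 : list A) f : sumL (l1 ++ l2) f = sumL l1 f + sumL l2 f.
Proof. induction l1; cbn [app]; rewrite ?sumL_nil, ?sumL_cons; lra. Qed.

Lemma sumL_ext {A} (l : list A) f g :
  (forall x, In x l -> f x = g x) -> sumL l f = sumL l g.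
Proof.
  induction l as [|x l IH]; intros H; [reflexivity|].
  rewrite !sumL_cons, H, IH; auto with datatypes.
Qed.

Lemma sumL_le {A} (l : list A) f g :
  (forall x, In x l -> f x <= g x) -> sumL l f <= sumL l g.
Proof.
  induction l as [|x l IH]; intros H; [apply Rle_refl|].
  rewrite !sumL_cons. apply Rplus_le_compat; auto with datatypes.
Qed.

Lemma sumL_plus {A} (l : list A) f g :
  sumL l (fun x => f x + g x) = sumL l f + sumL l g.
Proof. induction l; rewrite ?sumL_nil, ?sumL_cons; lra. Qed.

Lemma sumL_minus {A} (l : list A) f g :
  sumL l (fun x => f x - g x) = sumL l f - sumL l g.
Proof. induction l; rewrite ?sumL_nil, ?sumL_cons; lra. Qed.

Lemma sumL_scal {A} (l : list A) c f : sumL l (fun x => c * f x) = c * sumL l f.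
Proof. induction l; rewrite ?sumL_nil, ?sumL_cons; lra. Qed.

Lemma sumL_scal_r {A} (l : list A) c f : sumL l (fun x => f x * c) = sumL l f * c.
Proof. induction l; rewrite ?sumL_nil, ?sumL_cons; lra. Qed.

Lemma sumL_const {A} (l : list A) c : sumL l (fun _ => c) = INR (length l) * c.
Proof.
  induction l; [cbn; lra|]. rewrite sumL_cons, IHl. cbn [length]. rewrite S_INR. lra.
Qed.

Lemma sumL_zero {A} (l : list A) f : (forall x, In x l -> f x = 0) -> sumL l f = 0.
Proof. intros H. rewrite (sumL_ext _ _ (fun _ => 0)), sumL_const by exact H. lra. Qed.

Lemma sumL_nonneg {A} (l : list A) f : (forall x, In x l -> 0 <= f x) -> 0 <= sumL l f.
Proof.
  intros H. rewrite <- (sumL_zero l (fun _ => 0)) by reflexivity. now apply sumL_le.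
Qed.

Lemma sumL_pos {A} (l : list A) f x :
  (forall x, In x l -> 0 <= f x) -> In x l -> 0 < f x -> 0 < sumL l f.
Proof.
  induction l as [|z l IH]; intros H Hx Hp; [destruct Hx|]. rewrite sumL_cons.
  assert (0 <= f z) by auto with datatypes.
  assert (0 <= sumL l f) by (apply sumL_nonneg; auto with datatypes).
  destruct Hx as [->|Hx]; [lra|].
  assert (0 < sumL l f) by (apply IH; auto with datatypes). lra.
Qed.

Lemma sumL_ge_term {A} (l : list A) f x :
  (forall x, In x l -> 0 <= f x) -> In x l -> f x <= sumL l f.
Proof.
  induction l as [|z l IH]; intros H Hx; [destruct Hx|]. rewrite sumL_cons.
  assert (0 <= f z) by auto with datatypes.
  assert (0 <= sumL l f) by (apply sumL_nonneg; auto with datatypes).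
  destruct Hx as [->|Hx]; [lra|].
  assert (f x <= sumL l f) by (apply IH; auto with datatypes). lra.
Qed.

Lemma sumL_swap {A B} (l : list A) (m : list B) f :
  sumL l (fun x => sumL m (fun y => f x y)) = sumL m (fun y => sumL l (fun x => f x y)).
Proof.
  induction l as [|x l IH].
  - symmetry. now apply sumL_zero.
  - rewrite sumL_cons, IH, <- sumL_plus. apply sumL_ext. reflexivity.
Qed.

Lemma sumL_map {A B} (h : A -> B) (l : list A) f : sumL (map h l) f = sumL l (fun x => f (h x)).
Proof. unfold sumL. now rewrite map_map. Qed.

Lemma sumL_flat_map {A B} (h : A -> list B) (l : list A) f :
  sumL (flat_map h l) f = sumL l (fun x => sumL (h x) f).
Proof. induction l; [reflexivity|]. cbn [flat_map]. now rewrite sumL_app, IHl, sumL_cons. Qed.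

Lemma sumL_single {A} (eqd : forall x y : A, {x = y} + {x <> y}) (l : list A) z f :
  NoDup l -> In z l -> (forall x, In x l -> x <> z -> f x = 0) -> sumL l f = f z.
Proof.
  induction l as [|x l IH]; intros Hd Hz H; [destruct Hz|].
  inversion Hd; subst. rewrite sumL_cons. destruct (eqd x z) as [->|Hn].
  - rewrite (sumL_zero l f); [lra|]. intros u Hu. apply H; auto with datatypes.
    now intros ->.
  - destruct Hz as [->|Hz]; [congruence|]. rewrite IH, (H x); auto with datatypes. lra.
Qed.

Lemma ln_le_sub1 t : 0 < t -> ln t <= t - 1.
Proof.
  intros Ht. destruct (Req_dec (ln t) 0) as [E|Hn].
  - apply (f_equal exp) in E. rewrite exp_ln, exp_0 in E by easy. subst. rewrite ln_1. lra.
  - pose proof (exp_ineq1 (ln t) Hn) as H. rewrite exp_ln in H by easy. lra.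
Qed.

(** The supporting line of [t ln t] at [s]; summed over two laws it gives nonnegativity of relative
    entropy. At [t = 0] the factor [t] removes whatever value [ln] takes there. *)
Lemma mul_ln_ratio_ge t s : 0 <= t -> 0 < s -> t - s <= t * ln (t / s).
Proof.
  intros [Ht|<-] Hs; [|lra].
  assert (H : 0 < s / t) by (apply Rdiv_lt_0_compat; lra).
  pose proof (ln_le_sub1 _ H) as L.
  replace (t / s) with (/ (s / t)) by (field; lra). rewrite ln_Rinv by easy.
  apply Rmult_le_compat_l with (r := t) in L; [|lra].
  replace (t * (s / t - 1)) with (s - t) in L by (field; lra). lra.
Qed.

Lemma ln_le a b : 0 < a -> a <= b -> ln a <= ln b.
Proof. intros Ha [H| ->]; [left; now apply ln_increasing|lra]. Qed.

Lemma ln_div a b : 0 < a -> 0 < b -> ln (a / b) = ln a - ln b.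
Proof.
  intros. unfold Rdiv. rewrite ln_mult, ln_Rinv; auto using Rinv_0_lt_compat.
Qed.

Lemma ln_le_tangent t s : 0 < t -> 0 < s -> ln t <= ln s + (t / s - 1).
Proof.
  intros Ht Hs. pose proof (ln_le_sub1 (t / s) (Rdiv_lt_0_compat _ _ Ht Hs)) as L.
  rewrite ln_div in L by easy. lra.
Qed.

(** The tangent of [ln] at the mean [s] is summed against the weights. Weights may vanish, so
    positivity of [s] needs one positive weight, which exists because they sum to one. *)
Lemma jensen_ln {A} (l : list A) (c t : A -> R) :
  (forall x, In x l -> 0 <= c x) -> sumL l c = 1 -> (forall x, In x l -> 0 < t x) ->
  sumL l (fun x => c x * ln (t x)) <= ln (sumL l (fun x => c x * t x)).
Proof.
  intros Hc H1 Ht. set (s := sumL l (fun x => c x * t x)).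
  assert (Hs : 0 < s).
  { assert (H : exists x, In x l /\ 0 < c x).
    { destruct (Exists_dec (fun x => 0 < c x) l (fun x => Rlt_dec 0 (c x))) as [H|H].
      - now apply Exists_exists in H.
      - exfalso. rewrite sumL_zero in H1; [lra|]. intros x Hx.
        destruct (Hc x Hx) as [Hp|]; [|easy]. exfalso. apply H, Exists_exists. eauto. }
    destruct H as (x & Hx & Hp). apply sumL_pos with x; auto.
    - intros. apply Rmult_le_pos; auto. left; auto.
    - apply Rmult_lt_0_compat; auto. }
  apply Rle_trans with (sumL l (fun x => (ln s - 1) * c x + / s * (c x * t x))).
  - apply sumL_le. intros x Hx. pose proof (ln_le_tangent (t x) s (Ht x Hx) Hs) as L.
    apply Rmult_le_compat_l with (r := c x) in L; [|auto]. unfold Rdiv in L. lra.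
  - rewrite sumL_plus, !sumL_scal, H1. fold s. rewrite Rinv_l; lra.
Qed.

Lemma jensen_xlnx {A} (l : list A) (c t : A -> R) :
  (forall x, In x l -> 0 <= c x) -> sumL l c = 1 -> (forall x, In x l -> 0 < t x) ->
  let s := sumL l (fun x => c x * t x) in
  s * ln s <= sumL l (fun x => c x * (t x * ln (t x))).
Proof.
  intros Hc H1 Ht s.
  assert (Hs : 0 < s).
  { destruct (Rle_lt_dec s 0) as [H|H]; auto. exfalso.
    assert (Hz : forall x, In x l -> c x = 0).
    { intros x Hx. destruct (Hc x Hx) as [Hp|]; auto. exfalso.
      assert (0 < s); [|lra]. apply sumL_pos with x; auto.
      - intros. apply Rmult_le_pos; auto. left; auto.
      - apply Rmult_lt_0_compat; auto. }
    rewrite sumL_zero in H1 by exact Hz. lra. }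
  apply Rle_trans with (sumL l (fun x => (1 + ln s) * (c x * t x) - s * c x)).
  - rewrite sumL_minus, !sumL_scal, H1. fold s. lra.
  - apply sumL_le. intros x Hx.
    pose proof (mul_ln_ratio_ge (t x) s (Rlt_le _ _ (Ht x Hx)) Hs) as L.
    rewrite ln_div in L by auto.
    apply Rmult_le_compat_l with (r := c x) in L; [|auto]. lra.
Qed.

(** * Stopping times on the output tree *)

Lemma sumL_all_seqs_S ny n F :
  sumL (all_seqs ny (S n)) F =
  sumL (all_seqs ny n) (fun y => sumL (seq 0 ny) (fun a => F (y ++ [a]))).
Proof.
  cbn [all_seqs]. rewrite sumL_flat_map. apply sumL_ext. intros y _. now rewrite sumL_map.
Qed.

Lemma all_seqs_spec ny n y :
  In y (all_seqs ny n) -> length y = n /\ Forall (fun a => (a < ny)%nat) y.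
Proof.
  revert y. induction n as [|n IH]; intros y H; cbn [all_seqs] in H.
  - destruct H as [<-|[]]. auto.
  - apply in_flat_map in H as (s & Hs & H). apply in_map_iff in H as (a & <- & Ha).
    apply in_seq in Ha. destruct (IH _ Hs) as [Hl HF]. rewrite length_app. cbn. split; [lia|].
    apply Forall_app. split; auto. constructor; [lia|constructor].
Qed.

Lemma sum_f_R0_sumL f K : sum_f_R0 f K = sumL (seq 0 (S K)) f.
Proof.
  induction K as [|K IH].
  - cbn. lra.
  - rewrite seq_S, sumL_app, sumL_cons, sumL_nil. cbn [sum_f_R0]. rewrite IH. cbn [Nat.add]. lra.
Qed.

Section Tree.
Context (ny : nat) (stop : list nat -> bool).

(** This is the event that the stopping time is at least [length y]; stopping exactly at [y] is
    still allowed. *)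
Definition alive (y : list nat) : bool :=
  forallb (fun k => negb (stop (firstn k y))) (seq 0 (length y)).

Lemma alive_snoc y a : alive (y ++ [a]) = alive y && negb (stop y).
Proof.
  unfold alive. rewrite length_app. cbn [length]. rewrite Nat.add_1_r, seq_S, forallb_app.
  cbn [forallb Nat.add]. rewrite firstn_app, Nat.sub_diag, firstn_all. cbn [firstn].
  rewrite app_nil_r, andb_true_r. f_equal.
  assert (E : forall l, (forall k, In k l -> (k <= length y)%nat) ->
    forallb (fun k => negb (stop (firstn k (y ++ [a])))) l =
    forallb (fun k => negb (stop (firstn k y))) l).
  { induction l as [|k l IH]; intros H; [reflexivity|]. cbn [forallb].
    rewrite IH, firstn_app by auto with datatypes.
    replace (k - length y)%nat with 0%nat by (specialize (H k (or_introl eq_refl)); lia).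
    cbn [firstn]. now rewrite app_nil_r. }
  apply E. intros k Hk. apply in_seq in Hk. lia.
Qed.

Definition stopped_mass (F : list nat -> R) (n : nat) : R :=
  sumL (all_seqs ny n) (fun y => if stops_at stop y then F y else 0).

Definition alive_mass (F : list nat -> R) (n : nat) : R :=
  sumL (all_seqs ny n) (fun y => if alive y then F y else 0).

(* Expectation of [F] at time [min(tau, |y| + k)] on the event that the output starts with [y];
   [F] carries the path probability as a factor. *)
Fixpoint stopped_value (F : list nat -> R) (k : nat) (y : list nat) : R :=
  if stop y then F y else
  match k with
  | O => F y
  | S k => sumL (seq 0 ny) (fun a => stopped_value F k (y ++ [a]))
  end.

Lemma alive_mass_step F n :
  alive_mass F n = stopped_mass F n +
  sumL (all_seqs ny n) (fun y => if alive y && negb (stop y) then F y else 0).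
Proof.
  unfold alive_mass, stopped_mass. rewrite <- sumL_plus. apply sumL_ext. intros y _.
  unfold stops_at. fold (alive y). destruct (alive y), (stop y); cbn; lra.
Qed.

Lemma alive_mass_S F n :
  alive_mass F (S n) = sumL (all_seqs ny n) (fun y =>
    if alive y && negb (stop y) then sumL (seq 0 ny) (fun a => F (y ++ [a])) else 0).
Proof.
  unfold alive_mass. rewrite sumL_all_seqs_S. apply sumL_ext. intros y _.
  destruct (alive y && negb (stop y)) eqn:E.
  - apply sumL_ext. intros a _. now rewrite alive_snoc, E.
  - apply sumL_zero. intros a _. now rewrite alive_snoc, E.
Qed.

(** The value is unrolled one level of the tree at a time: stopped prefixes leave as [stopped_mass],
    the others are handed to level [S n]. *)
Lemma alive_mass_stopped_value F k n :
  alive_mass (stopped_value F k) n = sumL (seq n k) (stopped_mass F) + alive_mass F (n + k).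
Proof.
  revert n. induction k as [|k IH]; intros n.
  - cbn [seq]. rewrite sumL_nil, Rplus_0_l, Nat.add_0_r.
    apply sumL_ext. intros y _. cbn. now destruct (stop y).
  - rewrite alive_mass_step. cbn [seq]. rewrite sumL_cons. rewrite Nat.add_succ_r, <- Nat.add_succ_l.
    rewrite Rplus_assoc, <- IH, alive_mass_S. f_equal.
    + apply sumL_ext. intros y _. unfold stops_at. destruct (stop y) eqn:E; [|reflexivity].
      cbn. now rewrite E.
    + apply sumL_ext. intros y _. destruct (stop y) eqn:E; rewrite ?andb_false_r; [reflexivity|].
      cbn. now rewrite E.
Qed.

Lemma stopped_value_root F k :
  stopped_value F k [] = sumL (seq 0 k) (stopped_mass F) + alive_mass F k.
Proof.
  pose proof (alive_mass_stopped_value F k 0) as H. cbn [Nat.add] in H. rewrite <- H.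
  unfold alive_mass. cbn. lra.
Qed.

(** Optional stopping for a submartingale [Phi]; as [Phi] carries the path probability, the sum over
    the next letter is the conditional expectation. [P] restricts the hypotheses to well-formed
    prefixes. *)
Lemma stopped_value_ge (P : list nat -> Prop) F Phi :
  (forall y a, P y -> stop y = false -> (a < ny)%nat -> P (y ++ [a])) ->
  (forall y, P y -> Phi y <= F y) ->
  (forall y, P y -> stop y = false -> Phi y <= sumL (seq 0 ny) (fun a => Phi (y ++ [a]))) ->
  forall k y, P y -> Phi y <= stopped_value F k y.
Proof.
  intros HP H0 H1. induction k as [|k IH]; intros y Hy; cbn; destruct (stop y) eqn:E; auto.
  apply Rle_trans with (1 := H1 y Hy E). apply sumL_le. intros a Ha. apply in_seq in Ha.
  apply IH, HP; auto. lia.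
Qed.

Lemma stopped_value_le (P : list nat -> Prop) F Phi :
  (forall y a, P y -> stop y = false -> (a < ny)%nat -> P (y ++ [a])) ->
  (forall y, P y -> F y <= Phi y) ->
  (forall y, P y -> stop y = false -> sumL (seq 0 ny) (fun a => Phi (y ++ [a])) <= Phi y) ->
  forall k y, P y -> stopped_value F k y <= Phi y.
Proof.
  intros HP H0 H1. induction k as [|k IH]; intros y Hy; cbn; destruct (stop y) eqn:E; auto.
  apply Rle_trans with (2 := H1 y Hy E). apply sumL_le. intros a Ha. apply in_seq in Ha.
  apply IH, HP; auto. lia.
Qed.

Lemma stopped_value_plus F G k y :
  stopped_value (fun y => F y + G y) k y = stopped_value F k y + stopped_value G k y.
Proof.
  revert y. induction k as [|k IH]; intros y; cbn; destruct (stop y); auto.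
  rewrite <- sumL_plus. now apply sumL_ext.
Qed.

Lemma stopped_value_scal F c k y :
  stopped_value (fun y => c * F y) k y = c * stopped_value F k y.
Proof.
  revert y. induction k as [|k IH]; intros y; cbn; destruct (stop y); auto.
  rewrite <- sumL_scal. now apply sumL_ext.
Qed.

(** * Finiteness and truncated mean of a stopping time under an output law *)

Section Additive.
Context (Q : list nat -> R).
Hypothesis Qadd : forall y, sumL (seq 0 ny) (fun a => Q (y ++ [a])) = Q y.
Hypothesis Qnonneg : forall y, Forall (fun a => (a < ny)%nat) y -> 0 <= Q y.

Lemma alive_mass_nonneg n : 0 <= alive_mass Q n.
Proof.
  apply sumL_nonneg. intros y Hy. apply all_seqs_spec in Hy as [_ Hy].
  destruct (alive y); [auto|lra].
Qed.

Lemma stopped_mass_nonneg n : 0 <= stopped_mass Q n.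
Proof.
  apply sumL_nonneg. intros y Hy. apply all_seqs_spec in Hy as [_ Hy].
  destruct (stops_at stop y); [auto|lra].
Qed.

Lemma alive_mass_additive_step n : alive_mass Q n = stopped_mass Q n + alive_mass Q (S n).
Proof.
  rewrite alive_mass_step, alive_mass_S. f_equal. apply sumL_ext. intros y _. now rewrite Qadd.
Qed.

Lemma alive_mass_additive n k :
  alive_mass Q n = sumL (seq n k) (stopped_mass Q) + alive_mass Q (n + k).
Proof.
  revert n. induction k as [|k IH]; intros n.
  - cbn [seq]. rewrite sumL_nil, Nat.add_0_r. lra.
  - cbn [seq]. rewrite sumL_cons, alive_mass_additive_step, (IH (S n)).
    replace (n + S k)%nat with (S n + k)%nat by lia. lra.
Qed.

Lemma stopped_mass_length n :
  stopped_mass (fun y => INR (length y) * Q y) n = INR n * stopped_mass Q n.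
Proof.
  unfold stopped_mass. rewrite <- sumL_scal. apply sumL_ext. intros y Hy.
  apply all_seqs_spec in Hy as [-> _]. destruct (stops_at stop y); lra.
Qed.

Lemma alive_mass_length n :
  alive_mass (fun y => INR (length y) * Q y) n = INR n * alive_mass Q n.
Proof.
  unfold alive_mass. rewrite <- sumL_scal. apply sumL_ext. intros y Hy.
  apply all_seqs_spec in Hy as [-> _]. destruct (alive y); lra.
Qed.

Lemma stopped_value_length_root k :
  stopped_value (fun y => INR (length y) * Q y) k [] =
  sumL (seq 0 k) (fun n => INR n * stopped_mass Q n) + INR k * alive_mass Q k.
Proof.
  rewrite stopped_value_root, alive_mass_length. f_equal. apply sumL_ext.
  intros n _. apply stopped_mass_length.
Qed.

Lemma alive_mass_root : alive_mass Q 0 = Q [].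
Proof. cbn. lra. Qed.

Lemma stopped_mass_partial_sum K :
  sum_f_R0 (stopped_mass Q) K = Q [] - alive_mass Q (S K).
Proof.
  rewrite sum_f_R0_sumL, <- alive_mass_root, (alive_mass_additive 0 (S K)). cbn [Nat.add]. lra.
Qed.

Lemma alive_mass_cv0 :
  Un_cv (fun K => sum_f_R0 (stopped_mass Q) K) (Q []) ->
  forall eps, 0 < eps -> exists K0, forall K, (K >= K0)%nat -> alive_mass Q K < eps.
Proof.
  intros H eps He. destruct (H eps He) as [K0 HK]. exists (S K0). intros K HKK.
  destruct K as [|K]; [lia|]. specialize (HK K ltac:(lia)). unfold Rdist in HK.
  rewrite stopped_mass_partial_sum in HK.
  apply Rabs_def2 in HK. lra.
Qed.

(** Mass alive at time [k] is almost surely stopped later, at times at least [k], so truncation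
    cannot raise the mean. Only partial sums are at hand, so an excess [d > 0] is refuted at a
    horizon where the mass still alive is below [d / (k + 1)]. *)
Lemma truncated_mean_le N k :
  Un_cv (fun K => sum_f_R0 (stopped_mass Q) K) (Q []) ->
  (forall K, sum_f_R0 (fun n => INR n * stopped_mass Q n) K <= N) ->
  stopped_value (fun y => INR (length y) * Q y) k [] <= N.
Proof.
  intros Hcv HN. rewrite stopped_value_length_root. apply Rnot_lt_le. intros Hlt.
  set (d := sumL (seq 0 k) (fun n => INR n * stopped_mass Q n) + INR k * alive_mass Q k - N) in *.
  assert (Hk : 0 <= INR k) by apply pos_INR.
  destruct (alive_mass_cv0 Hcv (d / (INR k + 1))) as [K0 HK].
  { apply Rdiv_lt_0_compat; unfold d; lra. }
  specialize (HK (k + S K0)%nat ltac:(lia)).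
  pose proof (alive_mass_additive k (S K0)) as E.
  specialize (HN (k + K0)%nat). rewrite sum_f_R0_sumL in HN.
  replace (S (k + K0)) with (k + S K0)%nat in HN by lia.
  rewrite seq_app, sumL_app in HN. cbn [Nat.add] in HN.
  assert (Hge : INR k * sumL (seq k (S K0)) (stopped_mass Q) <=
                sumL (seq k (S K0)) (fun n => INR n * stopped_mass Q n)).
  { rewrite <- sumL_scal. apply sumL_le. intros n Hn. apply in_seq in Hn.
    apply Rmult_le_compat_r; [apply stopped_mass_nonneg|]. apply le_INR. lia. }
  assert (Hs : INR k * alive_mass Q (k + S K0) <= INR k * (d / (INR k + 1))).
  { apply Rmult_le_compat_l; lra. }
  assert (Hd : INR k * (d / (INR k + 1)) < d).
  { apply Rmult_lt_reg_r with (INR k + 1); [lra|].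
    replace (INR k * (d / (INR k + 1)) * (INR k + 1)) with (INR k * d) by (field; lra).
    assert (0 < d) by (unfold d; lra). nra. }
  rewrite E in *. unfold d in *. nra.
Qed.

(** Markov's inequality: [k] times the mass alive at time [k] is at most [V], so that mass tends to
    zero. *)
Lemma stopping_time_of_bound V :
  (forall k, stopped_value (fun y => INR (length y) * Q y) k [] <= V) ->
  Un_cv (fun K => sum_f_R0 (stopped_mass Q) K) (Q []) /\
  forall K, sum_f_R0 (fun n => INR n * stopped_mass Q n) K <= V.
Proof.
  intros HV. split.
  - intros eps He. destruct (INR_unbounded (V / eps)) as [K0 HK0]. exists K0.
    intros K HK. unfold Rdist. rewrite stopped_mass_partial_sum.
    pose proof (alive_mass_nonneg (S K)) as Ha. rewrite Rabs_left1 by lra.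
    specialize (HV (S K)). rewrite stopped_value_length_root in HV.
    assert (0 <= sumL (seq 0 (S K)) (fun n => INR n * stopped_mass Q n)).
    { apply sumL_nonneg. intros n _. apply Rmult_le_pos; [apply pos_INR|apply stopped_mass_nonneg]. }
    assert (Hlt : V / eps < INR (S K)).
    { apply Rlt_le_trans with (1 := HK0). apply le_INR. lia. }
    apply Rmult_lt_compat_r with (r := eps) in Hlt; [|easy].
    replace (V / eps * eps) with V in Hlt by (field; lra).
    apply Rnot_le_lt. intros Hc.
    assert (INR (S K) * eps <= INR (S K) * alive_mass Q (S K)); [|lra].
    apply Rmult_le_compat_l; [apply pos_INR|lra].
  - intros K. specialize (HV (S K)). rewrite stopped_value_length_root in HV.
    rewrite sum_f_R0_sumL. pose proof (pos_INR (S K)). pose proof (alive_mass_nonneg (S K)). nra.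
Qed.
End Additive.
End Tree.

(** * One-step drifts of the posterior *)

Lemma sumL_remove (l : list nat) w f :
  NoDup l -> In w l ->
  sumL l (fun v => if Nat.eq_dec v w then 0 else f v) = sumL l f - f w.
Proof.
  intros Hd Hw.
  assert (E : sumL l (fun v => if Nat.eq_dec v w then f v else 0) = f w).
  { rewrite (sumL_single Nat.eq_dec l w); auto.
    - now destruct (Nat.eq_dec w w).
    - intros v _ Hn. now destruct (Nat.eq_dec v w). }
  rewrite <- E, <- sumL_minus. apply sumL_ext. intros v _. destruct (Nat.eq_dec v w); lra.
Qed.

(** Convexity of [t ln t] at the mixture [P], used twice; the cross terms with [ln A] and [ln R]
    then recombine into the two directed divergences. This is the contribution of a single output
    letter. *)
Lemma binary_divergence_split p A R :
  0 <= p <= 1 -> 0 < A -> 0 < R ->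
  let P := p * A + (1 - p) * R in
  P * (2 * ln P - ln A - ln R) <= p * (A * ln (A / R)) + (1 - p) * (R * ln (R / A)).
Proof.
  intros Hp HA HR P.
  assert (HP : 0 < P).
  { destruct (Rle_lt_dec p (1/2)); unfold P; nra. }
  assert (L : P * ln P <= p * (A * ln A) + (1 - p) * (R * ln R)).
  { pose proof (mul_ln_ratio_ge A P (Rlt_le _ _ HA) HP) as L1.
    pose proof (mul_ln_ratio_ge R P (Rlt_le _ _ HR) HP) as L2.
    rewrite ln_div in L1, L2 by easy.
    apply Rmult_le_compat_l with (r := p) in L1; [|lra].
    apply Rmult_le_compat_l with (r := 1 - p) in L2; [|lra].
    assert (E : P * ln P = p * A * ln P + (1 - p) * R * ln P) by (unfold P; ring).
    assert (P = p * A + (1 - p) * R) by reflexivity. lra. }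
  rewrite !ln_div by easy.
  assert (E : P * (2 * ln P - ln A - ln R) =
    2 * (P * ln P) - (p * A + (1 - p) * R) * (ln A + ln R)) by (unfold P; ring).
  rewrite E. lra.
Qed.

Section Channel.
Context (nx ny : nat) (W : nat -> nat -> R) (lam B : R).
Hypothesis lam_pos : 0 < lam.
Hypothesis W_dichotomy : forall a, (a < ny)%nat ->
  (forall x, (x < nx)%nat -> W x a = 0) \/ (forall x, (x < nx)%nat -> lam <= W x a).
Hypothesis W_row : forall x, (x < nx)%nat -> sumL (seq 0 ny) (W x) = 1.
Hypothesis W_div : forall x x', (x < nx)%nat -> (x' < nx)%nat ->
  sumL (seq 0 ny) (fun a => W x a * ln (W x a / W x' a)) <= B.

Lemma W_nonneg x a : (x < nx)%nat -> (a < ny)%nat -> 0 <= W x a.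
Proof. intros Hx Ha. destruct (W_dichotomy a Ha) as [H|H]; specialize (H x Hx); lra. Qed.

Lemma W_le_1 x a : (x < nx)%nat -> (a < ny)%nat -> W x a <= 1.
Proof.
  intros Hx Ha. rewrite <- (W_row x Hx). apply sumL_ge_term; [|apply in_seq; lia].
  intros b Hb. apply in_seq in Hb. apply W_nonneg; auto. lia.
Qed.

(** * Divergences to and from mixtures of channel rows *)

Section Mixture.
Context (l : list nat) (c : nat -> R) (x : nat -> nat).
Hypothesis c_nonneg : forall v, In v l -> 0 <= c v.
Hypothesis c_sum : sumL l c = 1.
Hypothesis x_lt : forall v, In v l -> (x v < nx)%nat.

Definition mix (a : nat) : R := sumL l (fun v => c v * W (x v) a).

Lemma mix_dead a : (forall z, (z < nx)%nat -> W z a = 0) -> mix a = 0.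
Proof. intros H. apply sumL_zero. intros v Hv. rewrite H by auto. lra. Qed.

Lemma mix_live a : (forall z, (z < nx)%nat -> lam <= W z a) -> lam <= mix a.
Proof.
  intros H. unfold mix.
  replace lam with (sumL l (fun v => lam * c v)) by (rewrite sumL_scal, c_sum; lra).
  apply sumL_le. intros v Hv. specialize (H (x v) (x_lt v Hv)). specialize (c_nonneg v Hv). nra.
Qed.

Lemma mix_sum : sumL (seq 0 ny) mix = 1.
Proof.
  unfold mix. rewrite sumL_swap. rewrite <- c_sum. apply sumL_ext. intros v Hv.
  rewrite sumL_scal. change (c v * sumL (seq 0 ny) (W (x v)) = c v). rewrite W_row by auto. lra.
Qed.

Lemma average_div_le (d : nat -> nat -> R) :
  (forall v, In v l -> sumL (seq 0 ny) (d v) <= B) ->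
  sumL (seq 0 ny) (fun a => sumL l (fun v => c v * d v a)) <= B.
Proof.
  intros H. rewrite sumL_swap.
  apply Rle_trans with (sumL l (fun v => B * c v)).
  - apply sumL_le. intros v Hv. rewrite sumL_scal. rewrite (Rmult_comm B).
    now apply Rmult_le_compat_l; auto.
  - rewrite sumL_scal, c_sum. lra.
Qed.

(** Convexity of relative entropy in its second argument, letter by letter. *)
Lemma div_to_mix_le z : (z < nx)%nat ->
  sumL (seq 0 ny) (fun a => W z a * ln (W z a / mix a)) <= B.
Proof.
  intros Hz.
  apply Rle_trans with (2 := average_div_le (fun v a => W z a * ln (W z a / W (x v) a))
    (fun v Hv => W_div z (x v) Hz (x_lt v Hv))).
  apply sumL_le. intros a Ha. apply in_seq in Ha.
  destruct (W_dichotomy a ltac:(lia)) as [H|H].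
  - rewrite H by auto. rewrite sumL_zero; [lra|]. intros; lra.
  - pose proof (mix_live a H) as Hm. pose proof (H z Hz) as Hzl.
    assert (J : sumL l (fun v => c v * ln (W (x v) a)) <= ln (mix a)).
    { apply jensen_ln; auto. intros v Hv. specialize (H _ (x_lt v Hv)). lra. }
    rewrite ln_div by lra.
    rewrite (sumL_ext _ _ (fun v => W z a * ln (W z a) * c v - W z a * (c v * ln (W (x v) a)))).
    + rewrite sumL_minus, !sumL_scal, c_sum.
      apply Rmult_le_compat_l with (r := W z a) in J; lra.
    + intros v Hv. specialize (H _ (x_lt v Hv)). rewrite ln_div by lra. ring.
Qed.

(** Convexity of relative entropy in its first argument, here Jensen for [t ln t]. *)
Lemma div_from_mix_le z : (z < nx)%nat ->
  sumL (seq 0 ny) (fun a => mix a * ln (mix a / W z a)) <= B.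
Proof.
  intros Hz.
  apply Rle_trans with (2 := average_div_le (fun v a => W (x v) a * ln (W (x v) a / W z a))
    (fun v Hv => W_div (x v) z (x_lt v Hv) Hz)).
  apply sumL_le. intros a Ha. apply in_seq in Ha.
  destruct (W_dichotomy a ltac:(lia)) as [H|H].
  - rewrite mix_dead by auto. rewrite sumL_zero; [lra|].
    intros v Hv. rewrite (H _ (x_lt v Hv)). lra.
  - pose proof (mix_live a H) as Hm. pose proof (H z Hz) as Hzl.
    assert (J : mix a * ln (mix a) <= sumL l (fun v => c v * (W (x v) a * ln (W (x v) a)))).
    { apply jensen_xlnx; auto. intros v Hv. specialize (H _ (x_lt v Hv)). lra. }
    rewrite ln_div by lra.
    rewrite (sumL_ext _ _ (fun v => c v * (W (x v) a * ln (W (x v) a)) - ln (W z a) * (c v * W (x v) a))).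
    + rewrite sumL_minus, !sumL_scal. fold (mix a). lra.
    + intros v Hv. specialize (H _ (x_lt v Hv)). rewrite ln_div by lra. ring.
Qed.

Lemma div_to_mix_nonneg z : (z < nx)%nat ->
  0 <= sumL (seq 0 ny) (fun a => W z a * ln (W z a / mix a)).
Proof.
  intros Hz. replace 0 with (sumL (seq 0 ny) (fun a => W z a - mix a)).
  2:{ rewrite sumL_minus, mix_sum. change (sumL (seq 0 ny) (W z) - 1 = 0). rewrite W_row by auto. lra. }
  apply sumL_le. intros a Ha. apply in_seq in Ha.
  destruct (W_dichotomy a ltac:(lia)) as [H|H].
  - rewrite mix_dead, H by auto. lra.
  - pose proof (mix_live a H). apply mul_ln_ratio_ge; [|lra]. apply W_nonneg; auto. lia.
Qed.
End Mixture.

(** * Entropy, G and mean log-odds of the message *)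

Section Messages.
Context (M : nat).
Hypothesis M_ge2 : (2 <= M)%nat.
Notation msgs := (seq 1 M).

Definition tot (q : nat -> R) : R := sumL msgs q.
(** With [p = q / tot q], the next three are [tot q] times the Shannon entropy, times [1 - sum p^2],
    and times the mean log-odds U. *)
Definition ent (q : nat -> R) : R := sumL msgs (fun w => q w * ln (tot q / q w)).
Definition gini (q : nat -> R) : R := sumL msgs (fun w => q w * (tot q - q w)) / tot q.
Definition llr (q : nat -> R) : R := sumL msgs (fun w => q w * ln (q w / (tot q - q w))).
Definition step (q : nat -> R) (x : nat -> nat) (a : nat) (w : nat) : R := q w * W (x w) a.

Definition positive (q : nat -> R) : Prop := forall w, In w msgs -> 0 < q w.
Definition null (q : nat -> R) : Prop := forall w, In w msgs -> q w = 0.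

Lemma null_tot q : null q -> tot q = 0.
Proof. intros H. now apply sumL_zero. Qed.

Lemma null_ent q : null q -> ent q = 0.
Proof. intros H. apply sumL_zero. intros w Hw. rewrite (H w Hw). lra. Qed.

Lemma null_gini q : null q -> gini q = 0.
Proof.
  intros H. unfold gini. rewrite sumL_zero; [lra|]. intros w Hw. rewrite (H w Hw). lra.
Qed.

Lemma null_llr q : null q -> llr q = 0.
Proof. intros H. apply sumL_zero. intros w Hw. rewrite (H w Hw). lra. Qed.

Lemma tot_pos q : positive q -> 0 < tot q.
Proof.
  intros H. apply sumL_pos with 1%nat; [|apply in_seq; lia|apply H, in_seq; lia].
  intros w Hw. left. now apply H.
Qed.

Lemma others_pos q w : positive q -> In w msgs -> 0 < tot q - q w.
Proof.
  intros H Hw. unfold tot. rewrite <- (sumL_remove msgs w q); auto using seq_NoDup.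
  set (v := if Nat.eq_dec w 1 then 2%nat else 1%nat).
  assert (Hv : In v msgs /\ v <> w).
  { apply in_seq in Hw. unfold v. rewrite in_seq. destruct (Nat.eq_dec w 1); lia. }
  apply sumL_pos with v; [|tauto|].
  - intros u Hu. destruct (Nat.eq_dec u w); [lra|]. left. now apply H.
  - destruct (Nat.eq_dec v w); [tauto|]. apply H. tauto.
Qed.

Lemma gini_pos q : positive q -> 0 < gini q.
Proof.
  intros H. apply Rdiv_lt_0_compat; [|now apply tot_pos].
  apply sumL_pos with 1%nat; [|apply in_seq; lia|].
  - intros w Hw. left. apply Rmult_lt_0_compat; [now apply H|now apply others_pos].
  - apply Rmult_lt_0_compat; [apply H|apply others_pos; auto]; apply in_seq; lia.
Qed.

(** With [p] the posterior of [g], G is at most [1 - p^2 <= 2 (1 - p)], twice the error probability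
    of deciding for [g]. *)
Lemma gini_le_error q g : positive q -> In g msgs -> gini q <= 2 * (tot q - q g).
Proof.
  intros H Hg. pose proof (tot_pos q H) as HQ. unfold gini.
  apply Rmult_le_reg_r with (tot q); [easy|].
  unfold Rdiv. rewrite Rmult_assoc, Rinv_l, Rmult_1_r by lra.
  rewrite (sumL_ext _ _ (fun w => tot q * q w - q w * q w)) by (intros; ring).
  rewrite sumL_minus, sumL_scal. fold (tot q).
  assert (q g * q g <= sumL msgs (fun w => q w * q w)).
  { apply (sumL_ge_term msgs (fun w => q w * q w) g); auto. intros; nra. }
  pose proof (Rle_0_sqr (tot q - q g)) as S. unfold Rsqr in S. lra.
Qed.

Lemma gini_le_tot q : positive q -> gini q <= tot q.
Proof.
  intros H. pose proof (tot_pos q H) as HQ. unfold gini.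
  apply Rmult_le_reg_r with (tot q); [easy|].
  unfold Rdiv. rewrite Rmult_assoc, Rinv_l, Rmult_1_r by lra.
  rewrite (sumL_ext _ _ (fun w => tot q * q w - q w * q w)) by (intros; ring).
  rewrite sumL_minus, sumL_scal. fold (tot q).
  assert (0 <= sumL msgs (fun w => q w * q w)) by (apply sumL_nonneg; intros; nra).
  lra.
Qed.

(** Gibbs' inequality with a subprobability [r]; suitable [r] give the uniform bound and Fano's
    inequality. *)
Lemma ent_le_cross q r : positive q -> (forall w, In w msgs -> 0 < r w) -> sumL msgs r <= 1 ->
  ent q <= sumL msgs (fun w => q w * - ln (r w)).
Proof.
  intros H Hr H1. pose proof (tot_pos q H) as HQ.
  apply Rle_trans with (sumL msgs (fun w => q w * - ln (r w) + (tot q * r w - q w))).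
  - apply sumL_le. intros w Hw. specialize (H w Hw). specialize (Hr w Hw).
    assert (Hp : 0 < tot q * r w) by (apply Rmult_lt_0_compat; easy).
    pose proof (mul_ln_ratio_ge (q w) (tot q * r w) (Rlt_le _ _ H) Hp) as L.
    rewrite ln_div, ln_mult in L by easy. rewrite ln_div by easy. lra.
  - rewrite sumL_plus, sumL_minus, sumL_scal. fold (tot q). nra.
Qed.

Lemma ent_le_lnM q : positive q -> ent q <= tot q * ln (INR M).
Proof.
  intros H. assert (HM : 0 < INR M) by (apply lt_0_INR; lia).
  apply Rle_trans with (1 := ent_le_cross q (fun _ => / INR M) H
    ltac:(intros; now apply Rinv_0_lt_compat)
    ltac:(rewrite sumL_const, length_seq, Rinv_r; lra)).
  rewrite sumL_scal_r, ln_Rinv by easy. unfold tot. lra.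
Qed.

Lemma ent_le_fano q g : positive q -> In g msgs ->
  ent q <= tot q * ln 2 + (tot q - q g) * ln (INR M).
Proof.
  intros H Hg. assert (HM : 0 < INR M) by (apply lt_0_INR; lia).
  assert (HiM : 0 < / INR M) by (apply Rinv_0_lt_compat; easy).
  (* Half the weight sits on [g]: the cross-entropy is then [ln 2], plus [ln M] on the event that
     [g] is wrong. *)
  set (r := fun w => if Nat.eq_dec w g then / 2 else / (2 * INR M)).
  assert (Hr : sumL msgs r <= 1).
  { replace (sumL msgs r) with (r g + (sumL msgs r - r g)) by ring.
    rewrite <- (sumL_remove msgs g r) by auto using seq_NoDup.
    rewrite (sumL_ext _ _ (fun v => if Nat.eq_dec v g then 0 else / (2 * INR M))).
    2:{ intros v _. unfold r. now destruct (Nat.eq_dec v g). }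
    rewrite (sumL_remove msgs g (fun _ => / (2 * INR M))) by auto using seq_NoDup.
    rewrite sumL_const, length_seq. unfold r. destruct (Nat.eq_dec g g); [|congruence].
    replace (INR M * / (2 * INR M)) with (/ 2) by (field; lra).
    assert (0 < / (2 * INR M)) by (apply Rinv_0_lt_compat; lra). lra. }
  apply Rle_trans with (1 := ent_le_cross q r H
    ltac:(intros w _; unfold r; destruct (Nat.eq_dec w g); apply Rinv_0_lt_compat; lra) Hr).
  rewrite (sumL_ext _ _ (fun w => q w * ln 2 + (if Nat.eq_dec w g then 0 else q w) * ln (INR M))).
  - rewrite sumL_plus, !sumL_scal_r, sumL_remove by auto using seq_NoDup. unfold tot. lra.
  - intros w _. unfold r. destruct (Nat.eq_dec w g); rewrite ln_Rinv by lra.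
    + lra.
    + rewrite ln_mult by lra. lra.
Qed.

Lemma exists_argmax q : exists g, In g msgs /\ forall w, In w msgs -> q w <= q g.
Proof.
  assert (H : forall l : list nat, l <> [] -> exists g, In g l /\ forall w, In w l -> q w <= q g).
  { induction l as [|z l IH]; intros Hl; [easy|]. destruct l as [|z' l'].
    - exists z. split; [now left|]. intros w [->|[]]. lra.
    - destruct IH as (g & Hg & Hm); [easy|]. destruct (Rle_dec (q z) (q g)).
      + exists g. split; [now right|]. intros w [->|Hw]; auto.
      + exists z. split; [now left|]. intros w [->|Hw]; [lra|]. specialize (Hm w Hw). lra. }
  apply H. destruct M; [lia|]. easy.
Qed.

(** Fano at a most likely message [g]: since [1 - p_w >= 1 - p_g] in every term of G, G is at least
    the error probability of [g]. *)
Lemma ent_le_gini q : positive q -> ent q <= tot q * ln 2 + gini q * ln (INR M).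
Proof.
  intros H. destruct (exists_argmax q) as (g & Hg & Hm). pose proof (tot_pos q H) as HQ.
  apply Rle_trans with (1 := ent_le_fano q g H Hg).
  apply Rplus_le_compat_l, Rmult_le_compat_r.
  { rewrite <- ln_1. apply ln_le; [lra|]. apply (le_INR 1). lia. }
  unfold gini. apply Rmult_le_reg_r with (tot q); [easy|].
  unfold Rdiv. rewrite Rmult_assoc, Rinv_l, Rmult_1_r by lra.
  apply Rle_trans with (sumL msgs (fun w => (tot q - q g) * q w)).
  - rewrite sumL_scal. apply Rle_refl.
  - apply sumL_le. intros w Hw. specialize (Hm w Hw). specialize (H w Hw). nra.
Qed.

(** The odds [p / (1 - p)] are at least [p]. *)
Lemma llr_ge_neg_ent q : positive q -> - ent q <= llr q.
Proof.
  intros H. pose proof (tot_pos q H) as HQ.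
  replace (- ent q) with (sumL msgs (fun w => -1 * (q w * ln (tot q / q w))))
    by (rewrite sumL_scal; unfold ent; ring).
  apply sumL_le. intros w Hw. pose proof (H w Hw). pose proof (others_pos q w H Hw).
  rewrite !ln_div by easy. pose proof (ln_le (tot q - q w) (tot q)) as L. nra.
Qed.

Lemma llr_le q k : positive q -> 0 < k -> (forall w, In w msgs -> q w <= k * (tot q - q w)) ->
  llr q <= tot q * ln k.
Proof.
  intros H Hk Hb. unfold tot. rewrite <- sumL_scal_r. apply sumL_le. intros w Hw.
  pose proof (H w Hw) as Hw0. pose proof (others_pos q w H Hw) as Ho.
  apply Rmult_le_compat_l; [lra|]. apply ln_le; [now apply Rdiv_lt_0_compat|].
  apply Rmult_le_reg_r with (tot q - q w); [easy|].
  unfold Rdiv. rewrite Rmult_assoc, Rinv_l, Rmult_1_r by lra. now apply Hb.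
Qed.

(** * One channel use: drift identities and bounds *)

Section Step.
Context (q : nat -> R) (x : nat -> nat).
Hypothesis q_pos : positive q.
Hypothesis x_lt : forall w, In w msgs -> (x w < nx)%nat.

Lemma step_dead a : (forall z, (z < nx)%nat -> W z a = 0) -> null (step q x a).
Proof. intros H w Hw. unfold step. rewrite H by auto. lra. Qed.

Lemma step_live a : (forall z, (z < nx)%nat -> lam <= W z a) -> positive (step q x a).
Proof.
  intros H w Hw. apply Rmult_lt_0_compat; auto. specialize (H _ (x_lt w Hw)). lra.
Qed.

Lemma sum_step w : In w msgs -> sumL (seq 0 ny) (fun a => step q x a w) = q w.
Proof.
  intros Hw. unfold step. rewrite sumL_scal.
  change (q w * sumL (seq 0 ny) (W (x w)) = q w). rewrite W_row by auto. lra.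
Qed.

Lemma sum_tot_step : sumL (seq 0 ny) (fun a => tot (step q x a)) = tot q.
Proof. unfold tot. rewrite sumL_swap. apply sumL_ext. apply sum_step. Qed.

(** The posterior conditioned on the message not being [w]. *)
Definition other_weight (w v : nat) : R :=
  if Nat.eq_dec v w then 0 else q v / (tot q - q w).

Lemma other_weight_nonneg w v : In w msgs -> In v msgs -> 0 <= other_weight w v.
Proof.
  intros Hw Hv. unfold other_weight. destruct (Nat.eq_dec v w); [lra|].
  left. apply Rdiv_lt_0_compat; auto. now apply others_pos.
Qed.

Lemma other_weight_sum w : In w msgs -> sumL msgs (other_weight w) = 1.
Proof.
  intros Hw. unfold other_weight. rewrite sumL_remove by auto using seq_NoDup.
  unfold Rdiv. rewrite sumL_scal_r. fold (tot q).
  pose proof (others_pos q w q_pos Hw). field. lra.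
Qed.

Lemma mix_other w a : In w msgs ->
  mix msgs (other_weight w) x a = (tot (step q x a) - step q x a w) / (tot q - q w).
Proof.
  intros Hw. unfold mix, tot at 1. rewrite <- (sumL_remove msgs w (step q x a)) by auto using seq_NoDup.
  unfold Rdiv at 1. rewrite <- sumL_scal_r. apply sumL_ext. intros v Hv.
  unfold other_weight, step. pose proof (others_pos q w q_pos Hw).
  destruct (Nat.eq_dec v w); field; lra.
Qed.

Lemma mix_tot a : mix msgs (fun v => q v / tot q) x a = tot (step q x a) / tot q.
Proof.
  pose proof (tot_pos q q_pos). unfold mix. unfold Rdiv at 2. unfold tot at 2.
  rewrite <- sumL_scal_r. apply sumL_ext. intros v Hv. unfold step. field. lra.
Qed.

Lemma tot_weight_sum : sumL msgs (fun v => q v / tot q) = 1.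
Proof.
  pose proof (tot_pos q q_pos). unfold Rdiv. rewrite sumL_scal_r. fold (tot q). field. lra.
Qed.

Lemma mix_decompose w a : In w msgs ->
  tot (step q x a) / tot q =
  q w / tot q * W (x w) a + (1 - q w / tot q) * mix msgs (other_weight w) x a.
Proof.
  intros Hw. rewrite mix_other by auto. pose proof (others_pos q w q_pos Hw).
  pose proof (tot_pos q q_pos). unfold step at 3. field. lra.
Qed.

(** Bayes' rule: the odds of [w] are multiplied by [W (x w) a] over the output probability given any
    other message. Up to the factor [tot q], the right-hand side is the extrinsic Jensen-Shannon
    divergence. *)
Lemma llr_drift :
  sumL (seq 0 ny) (fun a => llr (step q x a)) - llr q =
  sumL msgs (fun w => q w * sumL (seq 0 ny) (fun a =>
    W (x w) a * ln (W (x w) a / mix msgs (other_weight w) x a))).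
Proof.
  unfold llr. rewrite sumL_swap, <- sumL_minus. apply sumL_ext. intros w Hw.
  pose proof (q_pos w Hw) as Hq. pose proof (others_pos q w q_pos Hw) as Ho.
  rewrite <- (sum_step w Hw) at 1. rewrite <- sumL_scal_r, <- sumL_minus, <- sumL_scal.
  apply sumL_ext. intros a Ha. apply in_seq in Ha. rewrite mix_other by auto.
  destruct (W_dichotomy a ltac:(lia)) as [H|H].
  - rewrite (step_dead a H w Hw), H by auto. lra.
  - pose proof (step_live a H) as Hp. pose proof (others_pos _ w Hp Hw).
    pose proof (Hp w Hw). pose proof (H _ (x_lt w Hw)).
    rewrite !ln_div; try lra; [|now apply Rdiv_lt_0_compat].
    replace (ln (step q x a w)) with (ln (q w) + ln (W (x w) a))
      by (unfold step; rewrite ln_mult; lra).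
    unfold step. ring.
Qed.

(** The right-hand side is [tot q] times the mutual information between the message and the next
    output. *)
Lemma ent_drift :
  ent q - sumL (seq 0 ny) (fun a => ent (step q x a)) =
  sumL msgs (fun w => q w * sumL (seq 0 ny) (fun a =>
    W (x w) a * ln (W (x w) a / mix msgs (fun v => q v / tot q) x a))).
Proof.
  unfold ent. rewrite sumL_swap, <- sumL_minus. apply sumL_ext. intros w Hw.
  pose proof (q_pos w Hw) as Hq. pose proof (tot_pos q q_pos) as Ho.
  rewrite <- (sum_step w Hw) at 1. rewrite <- sumL_scal_r, <- sumL_minus, <- sumL_scal.
  apply sumL_ext. intros a Ha. apply in_seq in Ha. rewrite mix_tot by auto.
  destruct (W_dichotomy a ltac:(lia)) as [H|H].
  - rewrite (step_dead a H w Hw), H by auto. lra.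
  - pose proof (step_live a H) as Hp. pose proof (tot_pos _ Hp).
    pose proof (Hp w Hw). pose proof (H _ (x_lt w Hw)).
    rewrite !ln_div; try lra; [|now apply Rdiv_lt_0_compat].
    replace (ln (step q x a w)) with (ln (q w) + ln (W (x w) a))
      by (unfold step; rewrite ln_mult; lra).
    unfold step. ring.
Qed.

(** This is [p_w (1 - p_w)] for the normalised posterior, the share of [w] in G. *)
Definition term (p : nat -> R) (w : nat) : R := p w * (tot p - p w) / (tot p * tot p).

Lemma gini_term p : positive p -> gini p / tot p = sumL msgs (term p).
Proof.
  intros H. pose proof (tot_pos p H). unfold gini, term, Rdiv at 3. rewrite sumL_scal_r.
  field. lra.
Qed.

Lemma term_pos p w : positive p -> In w msgs -> 0 < term p w.
Proof.
  intros H Hw. pose proof (tot_pos p H). pose proof (others_pos p w H Hw). specialize (H w Hw).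
  apply Rdiv_lt_0_compat; apply Rmult_lt_0_compat; easy.
Qed.

(** The posterior of [w] is multiplied by [A / P] and its complement by [R / P]. *)
Lemma term_step w a : In w msgs -> (forall z, (z < nx)%nat -> lam <= W z a) ->
  term (step q x a) w = term q w *
    (W (x w) a * mix msgs (other_weight w) x a /
     (tot (step q x a) / tot q * (tot (step q x a) / tot q))).
Proof.
  intros Hw H. pose proof (step_live a H) as Hp. pose proof (tot_pos q q_pos).
  pose proof (tot_pos _ Hp). pose proof (others_pos q w q_pos Hw). pose proof (q_pos w Hw).
  rewrite mix_other by auto. unfold term. unfold step at 1. field. lra.
Qed.

(** In the factor [A R / P^2] of each term, [A] and [R] are at least [lam], and [P] is at most
    one. *)
Lemma gini_step_ge a : (a < ny)%nat -> lam <= 1 ->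
  (forall z, (z < nx)%nat -> lam <= W z a) ->
  lam * lam * (gini q / tot q) <= gini (step q x a) / tot (step q x a).
Proof.
  intros Ha Hl1 H. pose proof (step_live a H) as Hp. rewrite !gini_term by auto.
  rewrite <- sumL_scal. apply sumL_le. intros w Hw.
  rewrite term_step, (Rmult_comm (lam * lam)) by auto.
  apply Rmult_le_compat_l; [left; now apply term_pos|].
  pose proof (H _ (x_lt w Hw)) as HA.
  pose proof (mix_live msgs _ x (fun v => other_weight_nonneg w v Hw) (other_weight_sum w Hw) x_lt a H) as HR.
  pose proof (mix_live msgs (fun v => q v / tot q) x) as HP.
  rewrite <- mix_tot.
  assert (HPl : lam <= mix msgs (fun v => q v / tot q) x a).
  { apply HP; auto using tot_weight_sum. intros v Hv. left. apply Rdiv_lt_0_compat; auto using tot_pos. }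
  assert (HP1 : mix msgs (fun v => q v / tot q) x a <= 1).
  { rewrite <- tot_weight_sum. apply sumL_le. intros v Hv. rewrite <- (Rmult_1_r (q v / tot q)) at 2.
    apply Rmult_le_compat_l; [left; apply Rdiv_lt_0_compat; auto using tot_pos|].
    apply W_le_1; auto. }
  set (P := mix msgs (fun v => q v / tot q) x a) in *.
  apply Rmult_le_reg_r with (P * P); [nra|].
  unfold Rdiv. rewrite (Rmult_assoc (W (x w) a * _)), Rinv_l, Rmult_1_r by nra.
  apply Rle_trans with (lam * lam * 1).
  - apply Rmult_le_compat_l; nra.
  - rewrite Rmult_1_r. apply Rmult_le_compat; lra.
Qed.

(** The mean of [ln (A R / P^2)] under [P] is [- D(P||A) - D(P||R)]. After [binary_divergence_split]
    only divergences between a row and a mixture of rows remain, each at most [B] by convexity. *)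
Lemma term_ln_drift w : In w msgs ->
  - B <= sumL (seq 0 ny) (fun a => tot (step q x a) / tot q * ln (term (step q x a) w / term q w)).
Proof.
  intros Hw. set (p := q w / tot q). pose proof (tot_pos q q_pos) as HQ.
  assert (Hp : 0 <= p <= 1).
  { pose proof (q_pos w Hw). pose proof (others_pos q w q_pos Hw). unfold p. split.
    - left. now apply Rdiv_lt_0_compat.
    - apply Rmult_le_reg_r with (tot q); [easy|].
      unfold Rdiv. rewrite Rmult_assoc, Rinv_l; lra. }
  pose proof (div_to_mix_le msgs (other_weight w) x (fun v => other_weight_nonneg w v Hw)
    (other_weight_sum w Hw) x_lt (x w) (x_lt w Hw)) as D1.
  pose proof (div_from_mix_le msgs (other_weight w) x (fun v => other_weight_nonneg w v Hw)
    (other_weight_sum w Hw) x_lt (x w) (x_lt w Hw)) as D2.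
  set (R_ := mix msgs (other_weight w) x) in *. set (A := W (x w)) in *.
  assert (L : sumL (seq 0 ny) (fun a => -1 * (tot (step q x a) / tot q * ln (term (step q x a) w / term q w)))
    <= sumL (seq 0 ny) (fun a => p * (A a * ln (A a / R_ a)) + (1 - p) * (R_ a * ln (R_ a / A a)))).
  { apply sumL_le. intros a Ha. apply in_seq in Ha.
    destruct (W_dichotomy a ltac:(lia)) as [H|H].
    - rewrite (null_tot _ (step_dead a H)). unfold R_, A.
      rewrite H, mix_dead by auto. lra.
    - pose proof (H _ (x_lt w Hw)) as HA. fold (A a) in HA.
      pose proof (mix_live msgs _ x (fun v => other_weight_nonneg w v Hw) (other_weight_sum w Hw) x_lt a H) as HR.
      fold (R_ a) in HR.
      assert (HP : 0 < tot (step q x a) / tot q).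
      { apply Rdiv_lt_0_compat; auto. apply tot_pos. now apply step_live. }
      pose proof (binary_divergence_split p (A a) (R_ a) Hp ltac:(lra) ltac:(lra)) as S. cbv zeta in S.
      unfold p, A, R_ in S. rewrite <- mix_decompose in S by auto. fold p (A a) (R_ a) in S.
      refine (Rle_trans _ _ _ _ S). right.
      rewrite term_step by auto. fold (A a) (R_ a).
      set (P := tot (step q x a) / tot q) in *.
      replace (term q w * (A a * R_ a / (P * P)) / term q w) with (A a * R_ a / (P * P))
        by (pose proof (term_pos q w q_pos Hw); field; split; lra).
      rewrite ln_div, (ln_mult P P), (ln_mult (A a)); try lra.
      + apply Rmult_lt_0_compat; lra.
      + now apply Rmult_lt_0_compat. }
  rewrite sumL_scal, sumL_plus, !sumL_scal in L. nra.
Qed.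

(** The ratio of the new G to the old one averages the ratios of the terms with weights [c]; by
    concavity its logarithm is at least the average of their logarithms, each of drift at least
    [- B]. *)
Lemma ln_gini_drift :
  tot q * ln (gini q / tot q) - B * tot q <=
  sumL (seq 0 ny) (fun a => tot (step q x a) * ln (gini (step q x a) / tot (step q x a))).
Proof.
  pose proof (tot_pos q q_pos) as HQ. pose proof (gini_pos q q_pos) as HG0.
  assert (HG : 0 < gini q / tot q) by now apply Rdiv_lt_0_compat.
  set (G := gini q / tot q) in *. set (c := fun w => term q w / G).
  assert (Hc : forall w, In w msgs -> 0 <= c w).
  { intros w Hw. left. apply Rdiv_lt_0_compat; auto. now apply term_pos. }
  assert (Hc1 : sumL msgs c = 1).
  { unfold c, Rdiv. rewrite sumL_scal_r, <- gini_term by auto. fold G. field. lra. }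
  set (d := fun w a => tot (step q x a) / tot q * ln (term (step q x a) w / term q w)).
  assert (L : sumL (seq 0 ny) (fun a => tot (step q x a) * ln G + tot q * sumL msgs (fun w => c w * d w a)) <=
    sumL (seq 0 ny) (fun a => tot (step q x a) * ln (gini (step q x a) / tot (step q x a)))).
  { apply sumL_le. intros a Ha. apply in_seq in Ha.
    destruct (W_dichotomy a ltac:(lia)) as [H|H].
    - unfold d. rewrite (null_tot _ (step_dead a H)).
      rewrite sumL_zero by (intros; lra). lra.
    - pose proof (step_live a H) as Hp. pose proof (tot_pos _ Hp) as HQ'.
      assert (J : sumL msgs (fun w => c w * ln (term (step q x a) w / term q w)) <=
                  ln (gini (step q x a) / tot (step q x a)) - ln G).
      { rewrite <- ln_div by (auto; apply Rdiv_lt_0_compat; auto; now apply gini_pos).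
        rewrite (gini_term _ Hp).
        replace (sumL msgs (term (step q x a)) / G)
          with (sumL msgs (fun w => c w * (term (step q x a) w / term q w))).
        - apply jensen_ln; auto. intros w Hw. apply Rdiv_lt_0_compat; now apply term_pos.
        - unfold Rdiv at 2. rewrite <- sumL_scal_r. apply sumL_ext.
          intros w Hw. pose proof (term_pos q w q_pos Hw). unfold c. field. split; lra. }
      apply Rmult_le_compat_l with (r := tot (step q x a)) in J; [|lra].
      rewrite <- sumL_scal in J |- *.
      rewrite (sumL_ext _ (fun w => tot q * (c w * d w a))
        (fun w => tot (step q x a) * (c w * ln (term (step q x a) w / term q w)))).
      + lra.
      + intros w _. unfold d. field. lra. }
  refine (Rle_trans _ _ _ _ L).
  rewrite sumL_plus, sumL_scal_r, sum_tot_step, sumL_scal, sumL_swap.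
  assert (- B <= sumL msgs (fun w => sumL (seq 0 ny) (fun a => c w * d w a))); [|nra].
  replace (- B) with (sumL msgs (fun w => c w * - B)) by (rewrite sumL_scal_r, Hc1; ring).
  apply sumL_le. intros w Hw. rewrite sumL_scal. apply Rmult_le_compat_l; auto.
  now apply term_ln_drift.
Qed.
End Step.
End Messages.
End Channel.

(** * Random input assignments *)

Section RandomAssignment.
Context (nx : nat) (Ps : nat -> R).
Hypothesis nx_pos : (0 < nx)%nat.
Hypothesis Ps_nonneg : forall x, (x < nx)%nat -> 0 <= Ps x.
Hypothesis Ps_sum : sumL (seq 0 nx) Ps = 1.

Definition upd (b : nat -> nat) (m z : nat) (w : nat) : nat := if Nat.eq_dec w m then z else b w.

(* Expectation over the values at [0, .., m-1], drawn independently from [Ps]. *)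
Fixpoint avg (m : nat) (F : (nat -> nat) -> R) : R :=
  match m with
  | O => F (fun _ => 0%nat)
  | S m => sumL (seq 0 nx) (fun z => Ps z * avg m (fun b => F (upd b m z)))
  end.

Lemma avg_ext m F G : (forall b, F b = G b) -> avg m F = avg m G.
Proof.
  revert F G. induction m as [|m IH]; intros F G H; cbn; auto.
  apply sumL_ext. intros z _. f_equal. apply IH. auto.
Qed.

Lemma avg_plus m F G : avg m (fun b => F b + G b) = avg m F + avg m G.
Proof.
  revert F G. induction m as [|m IH]; intros F G; cbn; auto.
  rewrite <- sumL_plus. apply sumL_ext. intros z _. rewrite IH. ring.
Qed.

Lemma avg_scal m c F : avg m (fun b => c * F b) = c * avg m F.
Proof.
  revert F. induction m as [|m IH]; intros F; cbn; auto.
  rewrite <- sumL_scal. apply sumL_ext. intros z _. rewrite IH. ring.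
Qed.

Lemma avg_const m c : avg m (fun _ => c) = c.
Proof.
  induction m as [|m IH]; cbn; auto.
  rewrite (sumL_ext _ _ (fun z => Ps z * c)), sumL_scal_r, Ps_sum; [lra|].
  intros z _. now rewrite IH.
Qed.

Lemma avg_sumL {A} m (l : list A) (F : A -> (nat -> nat) -> R) :
  avg m (fun b => sumL l (fun i => F i b)) = sumL l (fun i => avg m (F i)).
Proof.
  induction l as [|i l IH].
  - rewrite (avg_ext m _ (fun _ => 0)) by reflexivity. apply avg_const.
  - rewrite sumL_cons, <- IH, <- avg_plus. now apply avg_ext.
Qed.

Lemma avg_coord m w g : (w < m)%nat ->
  avg m (fun b => g (b w)) = sumL (seq 0 nx) (fun z => Ps z * g z).
Proof.
  induction m as [|m IH]; intros H; [lia|]. cbn. unfold upd.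
  destruct (Nat.eq_dec w m) as [->|Hn].
  - apply sumL_ext. intros z _. now rewrite avg_const.
  - rewrite (sumL_ext _ _ (fun z => Ps z * sumL (seq 0 nx) (fun z => Ps z * g z))).
    + rewrite sumL_scal_r, Ps_sum. lra.
    + intros z _. rewrite IH by lia. reflexivity.
Qed.

(** Independence of distinct coordinates. The quadratic bound in [exists_assignment] involves only
    such pairs and single coordinates. *)
Lemma avg_pair m w v g h : (w < m)%nat -> (v < m)%nat -> w <> v ->
  avg m (fun b => g (b w) * h (b v)) =
  sumL (seq 0 nx) (fun z => Ps z * g z) * sumL (seq 0 nx) (fun z => Ps z * h z).
Proof.
  induction m as [|m IH]; intros Hw Hv Hn; [lia|]. cbn. unfold upd.
  destruct (Nat.eq_dec w m) as [->|Hw']; destruct (Nat.eq_dec v m) as [->|Hv']; [easy| | |].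
  - rewrite <- sumL_scal_r. apply sumL_ext. intros z _. rewrite avg_scal, avg_coord by lia. ring.
  - rewrite <- sumL_scal. apply sumL_ext. intros z _.
    rewrite (avg_ext m _ (fun b => h z * g (b w))) by (intros; ring).
    rewrite avg_scal, avg_coord by lia. ring.
  - rewrite (sumL_ext _ _ (fun z => Ps z * (sumL (seq 0 nx) (fun z => Ps z * g z) *
      sumL (seq 0 nx) (fun z => Ps z * h z)))).
    + rewrite sumL_scal_r, Ps_sum. lra.
    + intros z _. rewrite IH by lia. reflexivity.
Qed.

(** The probabilistic method, one coordinate at a time: some value of the top coordinate does at
    least as well as the mean. *)
Lemma avg_attained m F :
  exists b, (forall w, (b w < nx)%nat) /\ avg m F <= F b.
Proof.
  revert F. induction m as [|m IH]; intros F.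
  - exists (fun _ => 0%nat). split; [auto|]. apply Rle_refl.
  - assert (H : exists z, (z < nx)%nat /\ avg (S m) F <= avg m (fun b => F (upd b m z))).
    { destruct (Exists_dec (fun z => avg (S m) F <= avg m (fun b => F (upd b m z))) (seq 0 nx)
        (fun z => Rle_dec _ _)) as [H|H].
      - apply Exists_exists in H as (z & Hz & H). exists z. split; auto. apply in_seq in Hz. lia.
      - exfalso. apply H, Exists_exists.
        assert (Hlt : forall z, In z (seq 0 nx) -> 0 <= Ps z * (avg (S m) F - avg m (fun b => F (upd b m z)))).
        { intros z Hz. apply Rmult_le_pos; [apply Ps_nonneg; apply in_seq in Hz; lia|].
          destruct (Rle_dec (avg (S m) F) (avg m (fun b => F (upd b m z)))); [|lra].
          exfalso. apply H, Exists_exists. eauto. }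
        assert (Hz : exists z, In z (seq 0 nx) /\ 0 < Ps z).
        { destruct (Exists_dec (fun z => 0 < Ps z) (seq 0 nx) (fun z => Rlt_dec 0 (Ps z))) as [E|E].
          - now apply Exists_exists in E.
          - exfalso. pose proof Ps_sum as S1. rewrite sumL_zero in S1; [lra|]. intros z Hz.
            destruct (Ps_nonneg z) as [Hp|]; [apply in_seq in Hz; lia| |easy].
            exfalso. apply E, Exists_exists. eauto. }
        destruct Hz as (z & Hz & Hp). exists z. split; auto. apply Rnot_lt_le. intros Hc.
        assert (0 < sumL (seq 0 nx) (fun z => Ps z * (avg (S m) F - avg m (fun b => F (upd b m z))))).
        { apply sumL_pos with z; auto. apply Rmult_lt_0_compat; lra. }
        rewrite (sumL_ext _ _ (fun z => avg (S m) F * Ps z - Ps z * avg m (fun b => F (upd b m z)))) in H0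
          by (intros; ring).
        rewrite sumL_minus, sumL_scal, Ps_sum in H0. cbn [avg] in H0. lra. }
    destruct H as (z & Hz & H). destruct (IH (fun b => F (upd b m z))) as (b & Hb & HF).
    exists (upd b m z). split; [|lra]. intros w. unfold upd. destruct (Nat.eq_dec w m); auto.
Qed.

Context (ny : nat) (W : nat -> nat -> R) (lam : R).
Hypothesis lam_pos : 0 < lam.
Hypothesis W_dichotomy : forall a, (a < ny)%nat ->
  (forall x, (x < nx)%nat -> W x a = 0) \/ (forall x, (x < nx)%nat -> lam <= W x a).

Definition PYs (a : nat) : R := sumL (seq 0 nx) (fun x => Ps x * W x a).

(* Bounding [ln] by its tangent at the output law [PYs] makes the gain a quadratic polynomial of
   the assignment, whose mean over independent inputs is the mutual information. *)
Lemma exists_assignment M q : (2 <= M)%nat -> positive M q ->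
  exists b, (forall w, (b w < nx)%nat) /\
    tot M q * sumL (seq 0 nx) (fun x => Ps x * sumL (seq 0 ny) (fun a => W x a * ln (W x a / PYs a))) <=
    sumL (seq 1 M) (fun w => q w * sumL (seq 0 ny) (fun a =>
      W (b w) a * ln (W (b w) a / mix W (seq 1 M) (other_weight M q w) b a))).
Proof.
  intros HM Hq.
  set (d := fun x a => W x a * ln (W x a / PYs a)).
  set (c := other_weight M q).
  set (F := fun b : nat -> nat => sumL (seq 1 M) (fun w => sumL (seq 0 ny) (fun a =>
    q w * d (b w) a + q w * W (b w) a +
    sumL (seq 1 M) (fun v => - (q w * c w v / PYs a) * (W (b w) a * W (b v) a))))).
  (* Messages are numbered from 1 to [M] and [avg] draws coordinates from 0 on, hence [S M]. *)
  destruct (avg_attained (S M) F) as (b & Hb & HF).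
  assert (Hlive : forall a, (forall x, (x < nx)%nat -> lam <= W x a) -> lam <= PYs a).
  { intros a H. apply (mix_live nx W lam (seq 0 nx) Ps (fun x => x)); auto;
    intros v Hv; apply in_seq in Hv; try apply Ps_nonneg; lia. }
  assert (Hdead : forall a, (forall x, (x < nx)%nat -> W x a = 0) -> PYs a = 0).
  { intros a H. apply sumL_zero. intros x Hx. apply in_seq in Hx. rewrite H by lia. lra. }
  exists b. split; [easy|]. apply Rle_trans with (F b); [apply Rle_trans with (2 := HF)|].
  - unfold F. rewrite avg_sumL. unfold tot. rewrite <- sumL_scal_r.
    apply sumL_le. intros w Hw. rewrite avg_sumL. rewrite <- sumL_scal.
    assert (HwM : (w < S M)%nat) by (apply in_seq in Hw; lia).
    rewrite (sumL_ext (seq 0 ny) _ (fun a => q w * sumL (seq 0 nx) (fun z => Ps z * d z a))).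
    + rewrite !sumL_scal, sumL_swap. right. f_equal. apply sumL_ext. intros x _.
      now rewrite sumL_scal.
    + intros a Ha. apply in_seq in Ha. rewrite !avg_plus, !avg_scal, avg_sumL.
      rewrite (avg_coord _ w (fun z => d z a)), (avg_coord _ w (fun z => W z a)) by easy.
      fold (PYs a).
      (* The linear and the quadratic correction of the tangent bound have means [q w * PYs a] and
         its negative, and cancel. *)
      rewrite (sumL_ext (seq 1 M) _ (fun v => - (q w * (PYs a * PYs a / PYs a)) * c w v)).
      * rewrite sumL_scal.
        change (sumL (seq 1 M) (fun v => c w v)) with (sumL (seq 1 M) (c w)).
        unfold c. rewrite other_weight_sum by auto.
        destruct (W_dichotomy a ltac:(lia)) as [H|H].
        -- rewrite (Hdead a H). lra.
        -- pose proof (Hlive a H). field. lra.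
      * intros v Hv. rewrite avg_scal. unfold c, other_weight.
        (* [other_weight] vanishes at [w] itself, so only independent inputs are multiplied. *)
        destruct (Nat.eq_dec v w) as [->|Hn]; [lra|].
        rewrite (avg_pair _ w v (fun z => W z a) (fun z => W z a)); auto.
        -- fold (PYs a). unfold Rdiv. ring.
        -- apply in_seq in Hv. lia.
  - apply sumL_le. intros w Hw. rewrite <- sumL_scal. apply sumL_le. intros a Ha.
    apply in_seq in Ha. pose proof (Hq w Hw) as Hqw.
    rewrite (sumL_ext (seq 1 M) _ (fun v => - (q w * W (b w) a / PYs a) * (c w v * W (b v) a)))
      by (intros; unfold Rdiv; ring).
    rewrite sumL_scal. fold (mix W (seq 1 M) (c w) b a).
    destruct (W_dichotomy a ltac:(lia)) as [H|H].
    + unfold d. rewrite (H (b w)) by auto. lra.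
    + pose proof (Hlive a H) as HP. pose proof (H (b w) (Hb w)) as HA.
      assert (HR : lam <= mix W (seq 1 M) (c w) b a).
      { apply (mix_live nx); auto.
        - intros v Hv. now apply other_weight_nonneg.
        - now apply other_weight_sum. }
      set (R_ := mix W (seq 1 M) (c w) b a) in *. unfold d.
      rewrite !ln_div by lra.
      pose proof (ln_le_tangent R_ (PYs a) ltac:(lra) ltac:(lra)) as L.
      apply Rmult_le_compat_l with (r := q w * W (b w) a) in L; [|nra].
      unfold Rdiv in *. lra.
Qed.
End RandomAssignment.

(** * Converse bound for one code *)

(** Terms excluded by the guard carry a zero factor, so the default values of [ln] and of division
    do not matter. *)
Lemma mutual_info_sum nx ny W P :
  is_channel nx ny W -> is_dist nx P ->
  mutual_info nx ny W P = sumL (seq 0 nx) (fun x => P x * sumL (seq 0 ny) (fun y =>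
    W x y * ln (W x y / PY nx W P y))).
Proof.
  intros (_ & _ & HW & _) [HP _]. apply sumL_ext. intros x Hx. apply in_seq in Hx.
  rewrite <- sumL_scal. apply sumL_ext. intros y Hy. apply in_seq in Hy.
  destruct (Rlt_dec 0 (P x * W x y)) as [H|H]; [ring|].
  assert (E : P x * W x y = 0).
  { pose proof (Rmult_le_pos _ _ (HP x ltac:(lia)) (HW x y ltac:(lia) ltac:(lia))). lra. }
  rewrite <- Rmult_assoc, E. ring.
Qed.

Lemma rel_ent_sum nx ny W x x' :
  is_channel nx ny W -> (x < nx)%nat ->
  rel_ent ny W x x' = sumL (seq 0 ny) (fun y => W x y * ln (W x y / W x' y)).
Proof.
  intros (_ & _ & HW & _) Hx. apply sumL_ext. intros y Hy. apply in_seq in Hy.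
  destruct (Rlt_dec 0 (W x y)) as [H|H]; [ring|].
  specialize (HW x y Hx ltac:(lia)). replace (W x y) with 0 by lra. ring.
Qed.

Lemma common_lower_bound (l : list (nat * nat)) (W : nat -> nat -> R) :
  exists lam, 0 < lam <= 1 /\
    forall x y, In (x, y) l -> 0 < W x y -> lam <= W x y.
Proof.
  induction l as [|[x y] l (lam & Hl & IH)].
  - exists 1. split; [lra|]. intros x y [].
  - destruct (Rlt_dec 0 (W x y)) as [H|H].
    + exists (Rmin lam (W x y)). split.
      * split; [apply Rmin_glb_lt; lra|]. pose proof (Rmin_l lam (W x y)). lra.
      * intros x' y' [E|Hin] Hp.
        -- inversion E; subst. apply Rmin_r.
        -- apply Rle_trans with (1 := Rmin_l _ _). auto.
    + exists lam. split; [easy|]. intros x' y' [E|Hin] Hp; [inversion E; subst; lra|auto].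
Qed.

(** Finite divergences in both directions give all rows the same support, and the finitely many
    positive entries have a common positive lower bound. *)
Lemma channel_dichotomy nx ny W :
  is_channel nx ny W ->
  (forall x x', (x < nx)%nat -> (x' < nx)%nat -> rel_ent_finite ny W x x') ->
  exists lam, 0 < lam <= 1 /\ forall y, (y < ny)%nat ->
    (forall x, (x < nx)%nat -> W x y = 0) \/ (forall x, (x < nx)%nat -> lam <= W x y).
Proof.
  intros (Hnx & _ & HW & _) Hfin.
  destruct (common_lower_bound (list_prod (seq 0 nx) (seq 0 ny)) W) as (lam & Hl & H).
  exists lam. split; [easy|]. intros y Hy. destruct (Rlt_dec 0 (W 0%nat y)) as [Hp|Hp].
  - right. intros x Hx. apply H.
    + apply in_prod; apply in_seq; lia.
    + now apply (Hfin 0%nat x).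
  - left. intros x Hx. destruct (HW x y Hx Hy) as [Hq|]; [|easy]. exfalso. apply Hp.
    now apply (Hfin x 0%nat).
Qed.

(** * Joint law of message and outputs under a fixed code *)

Section Code.
Context (nx ny : nat) (W : nat -> nat -> R) (lam : R).
Hypothesis lam_pos : 0 < lam.
Hypothesis W_dichotomy : forall a, (a < ny)%nat ->
  (forall x, (x < nx)%nat -> W x a = 0) \/ (forall x, (x < nx)%nat -> lam <= W x a).
Hypothesis W_row : forall x, (x < nx)%nat -> sumL (seq 0 ny) (W x) = 1.
Context (M : nat) (f : nat -> nat -> list nat -> nat).
Hypothesis f_lt : forall n w y, (f n w y < nx)%nat.

Definition joint (y : list nat) (w : nat) : R := / INR M * path_prob W f w y.

Definition input (y : list nat) (w : nat) : nat := f (S (length y)) w y.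

Notation valid := (Forall (fun a => (a < ny)%nat)).

Lemma path_prob_snoc w y a :
  path_prob W f w (y ++ [a]) = path_prob W f w y * W (input y w) a.
Proof.
  unfold path_prob. rewrite length_app. cbn [length]. rewrite Nat.add_1_r, seq_S, map_app.
  rewrite fold_right_app. cbn [map fold_right Nat.add].
  rewrite firstn_app, Nat.sub_diag, firstn_all. cbn [firstn]. rewrite app_nil_r, nth_middle.
  fold (input y w).
  assert (E : forall (l : list R) c, fold_right Rmult c l = fold_right Rmult 1 l * c).
  { intros l c. induction l as [|r l IH]; cbn; [ring|]. rewrite IH. ring. }
  rewrite E, Rmult_1_r. f_equal. f_equal. apply map_ext_in. intros i Hi. apply in_seq in Hi.
  rewrite firstn_app, app_nth1 by lia.
  replace (i - length y)%nat with 0%nat by lia. cbn [firstn]. now rewrite app_nil_r.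
Qed.

Lemma joint_snoc y a : joint (y ++ [a]) = step W (joint y) (input y) a.
Proof.
  apply functional_extensionality. intros w. unfold joint, step. rewrite path_prob_snoc. ring.
Qed.

Lemma joint_nil w : joint [] w = / INR M.
Proof. unfold joint, path_prob. cbn. ring. Qed.

Lemma joint_nonneg y w : valid y -> 0 <= joint y w.
Proof.
  revert w. induction y as [|a y IH] using rev_ind; intros w Hy.
  (* For [M = 0] the weight [/ INR M] is the default value 0. *)
  - rewrite joint_nil. destruct M as [|m]; [cbn; rewrite Rinv_0; lra|].
    left. apply Rinv_0_lt_compat, lt_0_INR. lia.
  - apply Forall_app in Hy as [Hy Ha]. inversion Ha; subst. rewrite joint_snoc.
    apply Rmult_le_pos; [now apply IH|]. apply (W_nonneg nx ny W lam); auto. apply f_lt.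
Qed.

Definition mass (y : list nat) : R := tot M (joint y).

Lemma mass_nonneg y : valid y -> 0 <= mass y.
Proof. intros Hy. apply sumL_nonneg. intros. now apply joint_nonneg. Qed.

Lemma mass_additive y : sumL (seq 0 ny) (fun a => mass (y ++ [a])) = mass y.
Proof.
  unfold mass. rewrite <- (sum_tot_step nx ny W W_row M (joint y) (input y)) by (intros; apply f_lt).
  apply sumL_ext. intros a _. now rewrite joint_snoc.
Qed.

Lemma stopped_mass_p_tau stop n : p_tau ny W M f stop n = stopped_mass ny stop mass n.
Proof.
  unfold p_tau, stopped_mass. rewrite sumL_swap. apply sumL_ext. intros y _.
  destruct (stops_at stop y); [reflexivity|]. now apply sumL_zero.
Qed.

Lemma stopped_mass_p_err g stop n : (forall y, (1 <= g y <= M)%nat) ->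
  p_err ny W M f g stop n = stopped_mass ny stop (fun y => mass y - joint y (g y)) n.
Proof.
  intros Hg. unfold p_err, stopped_mass. rewrite sumL_swap. apply sumL_ext. intros y _.
  destruct (stops_at stop y); cbn [andb]; [|now apply sumL_zero].
  unfold mass, tot. rewrite <- (sumL_remove (seq 1 M) (g y)); auto using seq_NoDup.
  - apply sumL_ext. intros w _. destruct (Nat.eq_dec w (g y)) as [->|Hn].
    + now rewrite Nat.eqb_refl.
    + destruct (Nat.eqb_spec (g y) w); [congruence|reflexivity].
  - apply in_seq. specialize (Hg y). lia.
Qed.

Hypothesis M_ge2 : (2 <= M)%nat.

Lemma INR_M_pos : 0 < INR M.
Proof. apply lt_0_INR. lia. Qed.

Lemma joint_nil_pos : positive M (joint []).
Proof. intros w _. rewrite joint_nil. apply Rinv_0_lt_compat, INR_M_pos. Qed.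

Lemma mass_nil : mass [] = 1.
Proof.
  unfold mass, tot. rewrite (sumL_ext _ _ (fun _ => / INR M)) by (intros; apply joint_nil).
  rewrite sumL_const, length_seq. pose proof INR_M_pos. field. lra.
Qed.

Lemma joint_dichotomy y : valid y -> null M (joint y) \/ positive M (joint y).
Proof.
  induction y as [|a y IH] using rev_ind; intros Hy; [right; apply joint_nil_pos|].
  apply Forall_app in Hy as [Hy Ha]. inversion Ha as [|? ? Ha']; subst. rewrite joint_snoc.
  destruct (IH Hy) as [Hn|Hp].
  - left. intros w Hw. unfold step. rewrite Hn by auto. ring.
  - destruct (W_dichotomy a Ha') as [HW|HW]; [left|right].
    + eapply step_dead; eauto.
    + eapply step_live; eauto.
Qed.

Lemma null_snoc y a : null M (joint y) -> null M (joint (y ++ [a])).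
Proof. intros H w Hw. rewrite joint_snoc. unfold step. rewrite H by auto. ring. Qed.

(** * Two-phase lower bound on time plus penalised error *)

Section Converse.
Context (B C : R).
Hypothesis lam_le1 : lam <= 1.
Hypothesis B_pos : 0 < B.
Hypothesis C_pos : 0 < C.
Hypothesis W_div : forall x x', (x < nx)%nat -> (x' < nx)%nat ->
  sumL (seq 0 ny) (fun a => W x a * ln (W x a / W x' a)) <= B.
Hypothesis W_cap : forall P, is_dist nx P ->
  sumL (seq 0 nx) (fun x => P x * sumL (seq 0 ny) (fun a =>
    W x a * ln (W x a / PY nx W P a))) <= C.

(** Change of variables for the input law that a law on messages induces through [x]. *)
Lemma sum_by_value (q : nat -> R) (x : nat -> nat) (h : nat -> R) :
  (forall w, In w (seq 1 M) -> (x w < nx)%nat) ->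
  sumL (seq 0 nx) (fun z => sumL (seq 1 M) (fun w => if Nat.eq_dec (x w) z then q w else 0) * h z) =
  sumL (seq 1 M) (fun w => q w * h (x w)).
Proof.
  intros Hx. rewrite (sumL_ext _ _ (fun z => sumL (seq 1 M) (fun w =>
    (if Nat.eq_dec (x w) z then q w else 0) * h z))) by (intros; now rewrite sumL_scal_r).
  rewrite sumL_swap. apply sumL_ext. intros w Hw.
  rewrite (sumL_single Nat.eq_dec _ (x w)); auto using seq_NoDup.
  - destruct (Nat.eq_dec (x w) (x w)); [ring|congruence].
  - apply in_seq. specialize (Hx w Hw). lia.
  - intros z _ Hn. destruct (Nat.eq_dec (x w) z); [congruence|ring].
Qed.

(** The posterior induces the input law [P] through [x]; its output law is the posterior mixture, so
    the entropy drift is the mutual information of [P], at most the capacity. *)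
Lemma ent_drift_le q x : positive M q -> (forall w, In w (seq 1 M) -> (x w < nx)%nat) ->
  ent M q - C * tot M q <= sumL (seq 0 ny) (fun a => ent M (step W q x a)).
Proof.
  intros Hq Hx. pose proof (tot_pos M M_ge2 q Hq) as HQ.
  pose proof (ent_drift nx ny W lam lam_pos W_dichotomy W_row M M_ge2 q x Hq Hx) as D.
  set (p := fun w => q w / tot M q).
  set (P := fun z => sumL (seq 1 M) (fun w => if Nat.eq_dec (x w) z then p w else 0)).
  assert (Hp : forall w, In w (seq 1 M) -> 0 <= p w).
  { intros w Hw. left. apply Rdiv_lt_0_compat; auto. }
  assert (HP : is_dist nx P).
  { split.
    - intros z _. apply sumL_nonneg. intros w Hw. destruct (Nat.eq_dec (x w) z); [auto|lra].
    - unfold sumR. change (sumL (seq 0 nx) P = 1).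
      rewrite (sumL_ext _ P (fun z => P z * 1)) by (intros; ring).
      unfold P. rewrite (sum_by_value p x (fun _ => 1)) by auto.
      rewrite (sumL_ext _ _ p) by (intros; ring). now apply tot_weight_sum. }
  specialize (W_cap P HP).
  assert (EP : forall a, PY nx W P a = mix W (seq 1 M) p x a).
  { intros a. unfold PY. change (sumL (seq 0 nx) (fun z => P z * W z a) = mix W (seq 1 M) p x a).
    apply (sum_by_value p x (fun z => W z a)). auto. }
  unfold P at 1 in W_cap. rewrite (sum_by_value p x) in W_cap by auto.
  apply Rmult_le_compat_l with (r := tot M q) in W_cap; [|lra].
  rewrite <- sumL_scal in W_cap.
  rewrite (sumL_ext _ _ (fun w => q w * sumL (seq 0 ny) (fun a =>
    W (x w) a * ln (W (x w) a / mix W (seq 1 M) p x a)))) in W_cap.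
  - fold p in D. lra.
  - intros w _. unfold p at 1.
    rewrite (sumL_ext (seq 0 ny) _ (fun a => W (x w) a * ln (W (x w) a / mix W (seq 1 M) p x a)))
      by (intros; now rewrite EP).
    field. lra.
Qed.

Lemma sum_length_mass y :
  sumL (seq 0 ny) (fun a => INR (length (y ++ [a])) * mass (y ++ [a])) =
  INR (length y) * mass y + mass y.
Proof.
  rewrite (sumL_ext _ _ (fun a => INR (S (length y)) * mass (y ++ [a]))).
  - rewrite sumL_scal, mass_additive, S_INR. ring.
  - intros a _. rewrite length_app. cbn [length]. now rewrite Nat.add_1_r.
Qed.

Context (stop : list nat -> bool) (g0 delta : R).
Hypothesis g0_pos : 0 < g0.
Hypothesis delta_bounds : 0 < delta <= / 2.

(* One step shrinks G by a factor at least [lam * lam], so the first value below [delta] is at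
   least [lam * lam * delta]; [ln G] at the end is bounded by its tangent at [g0]. *)
Definition kappa : R := 1 + ln (lam * lam * delta) - ln g0.

(** Elapsed time plus a penalty on G. The slope [/ (B * g0)] is that of the tangent to [ln G / B] at
    [g0]; [ln (INR M) / C] pays for the entropy left when the code stops before G has fallen below
    [delta]. *)
Definition cost (y : list nat) : R :=
  INR (length y) * mass y + (/ (B * g0) + ln (INR M) / C) * gini M (joint y).

(** Time spent so far plus the time to bring [ln G] down to [ln g0] at rate at most [B]; the 1 comes
    from the tangent. *)
Definition confirm_bound (y : list nat) : R :=
  INR (length y) * mass y +
  mass y * (ln (gini M (joint y) / mass y) - ln g0 + 1) / B.

(** The last term bounds from below the confirmation time due at the handover, less the time worth
    of the entropy [ln 2 + delta * ln M] that may remain there. *)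
Definition transmit_bound (y : list nat) : R :=
  INR (length y) * mass y + ent M (joint y) / C +
  mass y * (kappa / B - (ln 2 + delta * ln (INR M)) / C).

Lemma ln_M_nonneg : 0 <= ln (INR M).
Proof. rewrite <- ln_1. apply ln_le; [lra|]. apply (le_INR 1). lia. Qed.

Lemma cost_ge_gini y : valid y ->
  INR (length y) * mass y + gini M (joint y) / (B * g0) <= cost y.
Proof.
  intros Hy. unfold cost. assert (0 <= gini M (joint y)).
  { destruct (joint_dichotomy y Hy) as [H|H].
    - rewrite null_gini by auto. lra.
    - left. now apply gini_pos. }
  assert (0 <= ln (INR M) / C).
  { apply Rmult_le_pos; [apply ln_M_nonneg|left; now apply Rinv_0_lt_compat]. }
  unfold Rdiv at 1. nra.
Qed.

Lemma valid_snoc y a : valid y -> (a < ny)%nat -> valid (y ++ [a]).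
Proof. intros Hy Ha. apply Forall_app. auto. Qed.

(** [confirm_bound] is a submartingale under all inputs and at all values of G, so it stays valid if
    G rises above [delta] again. *)
Lemma confirm_bound_le k y : valid y -> confirm_bound y <= stopped_value ny stop cost k y.
Proof.
  apply (stopped_value_ge ny stop valid); clear k y.
  - intros y a Hy _ Ha. now apply valid_snoc.
  - intros y Hy. apply Rle_trans with (2 := cost_ge_gini y Hy).
    apply Rplus_le_compat_l. destruct (joint_dichotomy y Hy) as [H|H].
    + unfold mass. rewrite null_tot, null_gini by auto. lra.
    + pose proof (tot_pos M M_ge2 _ H) as HQ. pose proof (gini_pos M M_ge2 _ H) as HG.
      fold (mass y) in HQ.
      assert (HG' : 0 < gini M (joint y) / mass y) by now apply Rdiv_lt_0_compat.
      pose proof (ln_le_tangent _ g0 HG' g0_pos) as L.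
      apply Rle_trans with (mass y * (gini M (joint y) / mass y / g0) / B).
      * unfold Rdiv at 1 3. apply Rmult_le_compat_r; [left; now apply Rinv_0_lt_compat|].
        apply Rmult_le_compat_l; lra.
      * right. field. lra.
  - intros y Hy _. unfold confirm_bound. rewrite sumL_plus, sum_length_mass.
    destruct (joint_dichotomy y Hy) as [H|H].
    + rewrite sumL_zero.
      * unfold mass. rewrite null_tot by auto. lra.
      * intros a _. unfold mass. rewrite null_tot by now apply null_snoc. lra.
    + pose proof (ln_gini_drift nx ny W lam B lam_pos W_dichotomy W_row W_div M M_ge2
        (joint y) (input y) H (fun w _ => f_lt _ _ _)) as D. fold (mass y) in D.
      rewrite (sumL_ext _ _ (fun a => / B * (mass (y ++ [a]) * ln (gini M (joint (y ++ [a])) / mass (y ++ [a])))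
        + (1 - ln g0) / B * mass (y ++ [a]))) by (intros; unfold Rdiv; ring).
      rewrite sumL_plus, !sumL_scal, mass_additive.
      rewrite (sumL_ext _ _ (fun a => tot M (step W (joint y) (input y) a) *
        ln (gini M (step W (joint y) (input y) a) / tot M (step W (joint y) (input y) a))))
        by (intros; unfold mass; now rewrite joint_snoc).
      apply Rmult_le_compat_l with (r := / B) in D; [|left; now apply Rinv_0_lt_compat].
      replace (/ B * (mass y * ln (gini M (joint y) / mass y) - B * mass y))
        with (/ B * mass y * ln (gini M (joint y) / mass y) - mass y) in D by (field; lra).
      unfold Rdiv in *. lra.
Qed.

Lemma kappa_le : kappa <= delta / g0.
Proof.
  unfold kappa. assert (Hl : 0 < lam * lam * delta).
  { repeat apply Rmult_lt_0_compat; lra. }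
  pose proof (ln_le_tangent _ g0 Hl g0_pos) as L.
  assert (lam * lam * delta / g0 <= delta / g0); [|lra].
  apply Rmult_le_compat_r; [left; now apply Rinv_0_lt_compat|].
  assert (lam * lam <= 1) by nra. nra.
Qed.

(** The bound changes along the path, so the induction is done by hand: at the first prefix with G
    at most [delta] it passes to [confirm_bound]. The lower bound on G in the hypothesis limits the
    overshoot there; children inherit it because their parent has G above [delta]. *)
Lemma transmit_bound_le k y : valid y ->
  null M (joint y) \/ lam * lam * delta * mass y <= gini M (joint y) ->
  transmit_bound y <= stopped_value ny stop cost k y.
Proof.
  assert (HiC : 0 < / C) by now apply Rinv_0_lt_compat.
  assert (HiB : 0 < / B) by now apply Rinv_0_lt_compat.
  pose proof ln_M_nonneg as HM. pose proof lt_0_INR 2 ltac:(lia) as H2.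
  assert (Hln2 : 0 <= ln 2) by (rewrite <- ln_1; apply ln_le; lra).
  assert (Hl : 0 < lam * lam * delta) by (repeat apply Rmult_lt_0_compat; lra).
  revert y. induction k as [|k IH]; intros y Hy Hg.
  all: destruct (joint_dichotomy y Hy) as [H|H].
  (* A prefix of probability zero: both bounds vanish. *)
  1,3: apply Rle_trans with (2 := confirm_bound_le _ y Hy);
    unfold transmit_bound, confirm_bound, mass; rewrite null_tot, null_ent by auto; lra.
  all: destruct Hg as [Hg|Hg]; [specialize (H 1%nat ltac:(apply in_seq; lia));
    specialize (Hg 1%nat ltac:(apply in_seq; lia)); lra|].
  all: pose proof (tot_pos M M_ge2 _ H) as HQ; fold (mass y) in HQ.
  all: pose proof (gini_pos M M_ge2 _ H) as HG.
  all: pose proof (ent_le_gini M M_ge2 _ H) as HE; fold (mass y) in HE.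
  all: destruct (Rle_lt_dec (gini M (joint y)) (delta * mass y)) as [Hs|Hs].
  (* The handover: [L1] is the overshoot bound, [L2] the remaining entropy. *)
  1,3: apply Rle_trans with (2 := confirm_bound_le _ y Hy);
    unfold transmit_bound, confirm_bound; rewrite Rplus_assoc; apply Rplus_le_compat_l;
    assert (L1 : ln (lam * lam * delta) <= ln (gini M (joint y) / mass y))
      by (apply ln_le; [easy|]; apply Rmult_le_reg_r with (mass y); [easy|];
          unfold Rdiv; rewrite (Rmult_assoc (gini _ _)), Rinv_l; lra);
    assert (L2 : ent M (joint y) / C <= mass y * (ln 2 + delta * ln (INR M)) / C)
      by (apply Rmult_le_compat_r; nra);
    assert (L3 : mass y * kappa / B <= mass y * (ln (gini M (joint y) / mass y) - ln g0 + 1) / B)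
      by (apply Rmult_le_compat_r; [lra|]; apply Rmult_le_compat_l; unfold kappa; lra);
    unfold Rdiv in *; lra.
  (* Ending with G above [delta]: [ent_le_gini] and [kappa_le] charge everything to the two
     penalties on G. *)
  all: assert (Leaf : transmit_bound y <= cost y).
  1,3: unfold transmit_bound, cost; rewrite Rplus_assoc; apply Rplus_le_compat_l;
    pose proof kappa_le as HK;
    assert (L2 : ent M (joint y) / C <= (mass y * ln 2 + gini M (joint y) * ln (INR M)) / C)
      by (apply Rmult_le_compat_r; lra);
    assert (L3 : mass y * kappa / B <= gini M (joint y) / g0 / B)
      by (apply Rmult_le_compat_r; [lra|];
          apply Rle_trans with (mass y * (delta / g0)); [apply Rmult_le_compat_l; lra|];
          apply Rle_trans with (delta * mass y / g0); [right; field; lra|];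
          apply Rmult_le_compat_r; [left; now apply Rinv_0_lt_compat|lra]);
    replace (gini M (joint y) / g0 / B) with (/ (B * g0) * gini M (joint y)) in L3 by (field; lra);
    assert (L4 : 0 <= mass y * (delta * ln (INR M)) * / C)
      by (repeat apply Rmult_le_pos; lra);
    unfold Rdiv in *; lra.
  - cbn. now destruct (stop y).
  - cbn [stopped_value]. destruct (stop y); [easy|].
    apply Rle_trans with (sumL (seq 0 ny) (fun a => transmit_bound (y ++ [a]))).
    + unfold transmit_bound. rewrite !sumL_plus, sum_length_mass, sumL_scal_r, mass_additive.
      pose proof (ent_drift_le (joint y) (input y) H (fun w _ => f_lt _ _ _)) as D.
      fold (mass y) in D.
      change (sumL (seq 0 ny) (fun a => ent M (joint (y ++ [a])) / C))
        with (sumL (seq 0 ny) (fun a => ent M (joint (y ++ [a])) * / C)).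
      rewrite sumL_scal_r.
      rewrite (sumL_ext _ _ (fun a => ent M (step W (joint y) (input y) a)))
        by (intros; now rewrite joint_snoc).
      apply Rmult_le_compat_r with (r := / C) in D; [|lra].
      replace ((ent M (joint y) - C * mass y) * / C) with (ent M (joint y) / C - mass y) in D
        by (field; lra).
      lra.
    + apply sumL_le. intros a Ha. apply in_seq in Ha. apply IH.
      * apply valid_snoc; auto. lia.
      * destruct (W_dichotomy a ltac:(lia)) as [HW|HW]; rewrite joint_snoc.
        -- left. eapply step_dead; eauto.
        -- right. pose proof (gini_step_ge nx ny W lam lam_pos W_dichotomy W_row M M_ge2
             (joint y) (input y) H (fun w _ => f_lt _ _ _) a ltac:(lia) lam_le1 HW) as HGs.
           fold (mass y) in HGs. unfold mass. rewrite joint_snoc.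
           assert (Hp : positive M (step W (joint y) (input y) a)).
           { eapply (step_live nx W lam); eauto. }
           pose proof (tot_pos M M_ge2 _ Hp) as HQ'.
           set (Q' := tot M (step W (joint y) (input y) a)) in *.
           apply Rmult_le_reg_r with (/ Q'); [now apply Rinv_0_lt_compat|].
           rewrite Rmult_assoc, Rinv_r, Rmult_1_r by lra.
           apply Rle_trans with (2 := HGs). rewrite Rmult_assoc.
           rewrite <- (Rmult_assoc lam lam delta).
           apply Rmult_le_compat_l; [nra|].
           apply Rmult_le_reg_r with (mass y); [easy|].
           unfold Rdiv. rewrite (Rmult_assoc (gini _ _)), Rinv_l; lra.
Qed.

Lemma gini_nil : lam * lam * delta * mass [] <= gini M (joint []).
Proof.
  assert (E : gini M (joint []) = 1 - / INR M).
  { unfold gini. fold (mass []). rewrite mass_nil.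
    rewrite (sumL_ext _ _ (fun _ => / INR M * (1 - / INR M))) by (intros; now rewrite joint_nil).
    rewrite sumL_const, length_seq. pose proof INR_M_pos. field. lra. }
  assert (HM : / INR M <= / 2).
  { apply Rinv_le_contravar; [lra|]. apply (le_INR 2). lia. }
  rewrite E, mass_nil. assert (lam * lam <= 1) by nra. nra.
Qed.

Lemma ent_nil : ent M (joint []) = ln (INR M).
Proof.
  pose proof INR_M_pos. unfold ent. fold (mass []). rewrite mass_nil.
  rewrite (sumL_ext _ _ (fun _ => / INR M * ln (INR M))).
  - rewrite sumL_const, length_seq. field. lra.
  - intros w _. rewrite joint_nil. unfold Rdiv. now rewrite Rinv_inv, Rmult_1_l.
Qed.

(** The transmission bound at the root is compared with the mean cost: time contributes at most [N],
    and G has mean at most [2 * Pe] at the decision. *)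
Lemma converse_bound g N Pe :
  (forall y, (1 <= g y <= M)%nat) ->
  Un_cv (fun K => sum_f_R0 (p_tau ny W M f stop) K) 1 ->
  (forall K, sum_f_R0 (fun n => INR n * p_tau ny W M f stop n) K <= N) ->
  Un_cv (fun K => sum_f_R0 (p_err ny W M f g stop) K) Pe ->
  (1 - delta - 2 * Pe) * ln (INR M) / C + kappa / B - ln 2 / C <= N + 2 * Pe / (B * g0).
Proof.
  intros Hg Hcv HN HPe.
  assert (Etau : forall K, sum_f_R0 (p_tau ny W M f stop) K = sum_f_R0 (stopped_mass ny stop mass) K)
    by (intros K; apply sum_eq; intros; apply stopped_mass_p_tau).
  assert (Hcv' : Un_cv (fun K => sum_f_R0 (stopped_mass ny stop mass) K) (mass [])).
  { rewrite mass_nil. intros e He. destruct (Hcv e He) as [K0 HK]. exists K0. intros K HKK.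
    rewrite <- Etau. now apply HK. }
  assert (HN' : forall K, sum_f_R0 (fun n => INR n * stopped_mass ny stop mass n) K <= N).
  { intros K. rewrite <- (HN K). right. apply sum_eq. intros. now rewrite stopped_mass_p_tau. }
  assert (Herr : forall K, sum_f_R0 (p_err ny W M f g stop) K <= Pe).
  { apply growing_ineq; auto. intros K. cbn [sum_f_R0].
    rewrite stopped_mass_p_err by auto.
    assert (0 <= stopped_mass ny stop (fun y => mass y - joint y (g y)) (S K)); [|lra].
    apply sumL_nonneg. intros y Hy. apply all_seqs_spec in Hy as [_ Hy].
    destruct (stops_at stop y); [|lra].
    assert (joint y (g y) <= mass y); [|lra].
    apply sumL_ge_term; [intros; now apply joint_nonneg|].
    apply in_seq. specialize (Hg y). lia. }
  set (Z := / (B * g0) + ln (INR M) / C).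
  assert (HZ : 0 < Z).
  { assert (0 < / (B * g0)) by (apply Rinv_0_lt_compat; nra).
    assert (0 <= ln (INR M) / C).
    { apply Rmult_le_pos; [apply ln_M_nonneg|left; now apply Rinv_0_lt_compat]. }
    unfold Z. lra. }
  (* At a finite horizon the mass still alive is charged in full, as G is at most one; it vanishes
     in the limit. *)
  assert (Main : forall K, transmit_bound [] <= N + Z * (2 * Pe + alive_mass ny stop mass (S K))).
  { intros K.
    apply Rle_trans with (1 := transmit_bound_le (S K) [] (Forall_nil _) (or_intror gini_nil)).
    unfold cost. rewrite stopped_value_plus, stopped_value_scal.
    apply Rplus_le_compat; [apply truncated_mean_le; auto using mass_additive, mass_nonneg|].
    apply Rmult_le_compat_l; [lra|]. rewrite stopped_value_root. apply Rplus_le_compat.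
    - apply Rle_trans with (2 * sum_f_R0 (p_err ny W M f g stop) K); [|specialize (Herr K); lra].
      rewrite sum_f_R0_sumL, <- sumL_scal. apply sumL_le. intros n _.
      rewrite stopped_mass_p_err by auto. unfold stopped_mass. rewrite <- sumL_scal.
      apply sumL_le. intros y Hy. apply all_seqs_spec in Hy as [_ Hy].
      destruct (stops_at stop y); [|lra]. destruct (joint_dichotomy y Hy) as [H|H].
      + rewrite null_gini by auto. unfold mass. rewrite null_tot, H by
          (auto; apply in_seq; specialize (Hg y); lia). lra.
      + apply gini_le_error; auto. apply in_seq. specialize (Hg y). lia.
    - apply sumL_le. intros y Hy. apply all_seqs_spec in Hy as [_ Hy].
      destruct (alive stop y); [|lra]. destruct (joint_dichotomy y Hy) as [H|H].
      + rewrite null_gini by auto. unfold mass. rewrite null_tot by auto. lra.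
      + now apply gini_le_tot. }
  assert (Lim : transmit_bound [] <= N + Z * (2 * Pe)).
  { apply Rnot_lt_le. intros Hlt.
    destruct (alive_mass_cv0 ny stop mass mass_additive Hcv'
      ((transmit_bound [] - (N + Z * (2 * Pe))) / Z)) as [K0 HK].
    { apply Rdiv_lt_0_compat; lra. }
    specialize (HK (S K0) ltac:(lia)). specialize (Main K0).
    apply Rmult_lt_compat_l with (r := Z) in HK; [|easy].
    replace (Z * ((transmit_bound [] - (N + Z * (2 * Pe))) / Z))
      with (transmit_bound [] - (N + Z * (2 * Pe))) in HK by (field; lra). lra. }
  unfold transmit_bound, Z in Lim. rewrite ent_nil, mass_nil in Lim. cbn [length INR] in Lim.
  unfold Rdiv in *. lra.
Qed.
End Converse.
End Code.

(** * A code with confirmation phase *)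

Section Scheme.
Context (nx ny : nat) (W : nat -> nat -> R) (lam B C : R).
Hypothesis lam_pos : 0 < lam.
Hypothesis lam_le1 : lam <= 1.
Hypothesis B_pos : 0 < B.
Hypothesis C_pos : 0 < C.
Hypothesis W_dichotomy : forall a, (a < ny)%nat ->
  (forall x, (x < nx)%nat -> W x a = 0) \/ (forall x, (x < nx)%nat -> lam <= W x a).
Hypothesis W_row : forall x, (x < nx)%nat -> sumL (seq 0 ny) (W x) = 1.
Context (xc xr : nat).
Hypothesis xc_lt : (xc < nx)%nat.
Hypothesis xr_lt : (xr < nx)%nat.
Hypothesis W_xc_xr : sumL (seq 0 ny) (fun a => W xc a * ln (W xc a / W xr a)) = B.
Context (M : nat).
Hypothesis M_ge2 : (2 <= M)%nat.
Notation msgs := (seq 1 M).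
Notation valid := (Forall (fun a => (a < ny)%nat)).

Context (assign : (nat -> R) -> nat -> nat).
Hypothesis assign_lt : forall q w, (assign q w < nx)%nat.
Hypothesis assign_gain : forall q, positive M q ->
  tot M q * C <= sumL msgs (fun w => q w * sumL (seq 0 ny) (fun a =>
    W (assign q w) a * ln (W (assign q w) a / mix W msgs (other_weight M q w) (assign q) a))).

(** Levels for the posterior probability of the other messages: confirmation starts at [eta], is
    abandoned above [e1], and the code stops at [eps]. *)
Context (N eps eta e1 : R).
Hypothesis eps_pos : 0 < eps.
Hypothesis eps_le : eps <= eta.
Hypothesis eta_le : eta <= e1.
Hypothesis e1_le : e1 <= / 2.

Definition at_least (r : R) (q : nat -> R) (w : nat) : bool :=
  if Rle_dec (r * tot M q) (q w) then true else false.

Lemma at_least_spec r q w : at_least r q w = true <-> r * tot M q <= q w.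
Proof. unfold at_least. destruct (Rle_dec (r * tot M q) (q w)); split; auto; discriminate. Qed.

Definition candidate (q : nat -> R) : nat :=
  match find (at_least (1 - eta) q) msgs with Some w => w | None => 0 end.

(* A state is the joint law of message and past outputs, together with the message being
   confirmed, [0] meaning none. *)
Definition encode (s : (nat -> R) * nat) (w : nat) : nat :=
  if Nat.eqb (snd s) 0 then assign (fst s) w else if Nat.eq_dec w (snd s) then xc else xr.

(** When a confirmation is abandoned the search for a candidate is repeated at once, so another
    message may be confirmed next without a transmission step. *)
Definition advance (s : (nat -> R) * nat) (a : nat) : (nat -> R) * nat :=
  let q := step W (fst s) (encode s) a in
  (q, if negb (Nat.eqb (snd s) 0) && at_least (1 - e1) q (snd s) then snd s else candidate q).

Definition state (y : list nat) : (nat -> R) * nat :=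
  fold_left advance y ((fun _ => / INR M), 0%nat).

Definition enc (n w : nat) (y : list nat) : nat := encode (state y) w.
Definition stop_rule (y : list nat) : bool :=
  negb (Nat.eqb (snd (state y)) 0) && at_least (1 - eps) (fst (state y)) (snd (state y)).
Definition dec (y : list nat) : nat :=
  if Nat.eqb (snd (state y)) 0 then 1%nat else snd (state y).

Lemma state_snoc y a : state (y ++ [a]) = advance (state y) a.
Proof. unfold state. now rewrite fold_left_app. Qed.

Lemma candidate_spec q : candidate q = 0%nat /\ (forall w, In w msgs -> q w < (1 - eta) * tot M q) \/
  In (candidate q) msgs /\ (1 - eta) * tot M q <= q (candidate q).
Proof.
  unfold candidate. destruct (find _ _) as [w|] eqn:E.
  - right. apply find_some in E as [Hw E]. apply at_least_spec in E. auto.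
  - left. split; auto. intros w Hw. pose proof (find_none _ _ E w Hw) as H.
    apply Rnot_le_lt. intros Hc. apply at_least_spec in Hc. congruence.
Qed.

Lemma mode_range y : snd (state y) = 0%nat \/ In (snd (state y)) msgs.
Proof.
  induction y as [|a y IH] using rev_ind; [now left|]. rewrite state_snoc. cbn.
  destruct (negb _ && _) eqn:E; auto.
  destruct (candidate_spec (step W (fst (state y)) (encode (state y)) a)) as [[H _]|[H _]]; auto.
Qed.

Lemma encode_lt s w : (encode s w < nx)%nat.
Proof. unfold encode. destruct (Nat.eqb _ 0); auto. destruct (Nat.eq_dec w (snd s)); auto. Qed.

Lemma enc_lt n w y : (enc n w y < nx)%nat.
Proof. apply encode_lt. Qed.

Lemma dec_range y : (1 <= dec y <= M)%nat.
Proof.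
  unfold dec. destruct (mode_range y) as [H|H].
  - rewrite H. cbn. lia.
  - apply in_seq in H. destruct (Nat.eqb_spec (snd (state y)) 0); lia.
Qed.

Lemma joint_state y : joint W M enc y = fst (state y).
Proof.
  induction y as [|a y IH] using rev_ind.
  - apply functional_extensionality. intros w. apply joint_nil.
  - rewrite joint_snoc, IH, state_snoc. reflexivity.
Qed.

(** A posterior of at most [1 - eta] has odds at most [/ eta], and one step multiplies odds by at
    most [/ lam]; so [c1] bounds the log-odds just after transmission ends, and [c2] those at
    stopping. *)
Definition c1 : R := ln (/ eta / lam).
Definition c2 : R := ln (/ eps / lam).
Definition B' : R := (1 - e1) * B.
(** What [N] leaves after a transmission that raises U from [- ln M] to [c1] at rate [C]. *)
Definition K2 : R := N - (c1 + ln (INR M)) / C.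

(** A confirmation begun at level [eta], with its expected fallback price [eta * (N / e1)], fits
    into what transmission leaves. *)
Hypothesis budget : (c2 + ln 2 + eta * ln (INR M)) / B' + eta * (N / e1) <= K2.

(* Remaining time: [N] also serves as the price of falling back from confirmation, which is
   charged to the posterior mass [tot q - q m] of the other messages. *)
Definition potential (s : (nat -> R) * nat) : R :=
  let q := fst s in
  if Nat.eqb (snd s) 0 then (c1 * tot M q - llr M q) / C + K2 * tot M q
  else (c2 * tot M q - llr M q) / B' + (tot M q - q (snd s)) * (N / e1).

Lemma B'_pos : 0 < B'.
Proof. apply Rmult_lt_0_compat; lra. Qed.

Lemma inv_ge1 t : 0 < t <= 1 -> 1 <= / t.
Proof. intros H. rewrite <- Rinv_1. apply Rinv_le_contravar; lra. Qed.

Lemma ratio_ge1 t : 0 < t <= 1 -> 1 <= / t / lam.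
Proof.
  intros H. pose proof (inv_ge1 t H). pose proof (inv_ge1 lam (conj lam_pos lam_le1)).
  unfold Rdiv. nra.
Qed.

Lemma c1_nonneg : 0 <= c1.
Proof. rewrite <- ln_1. apply ln_le; [lra|]. apply ratio_ge1. lra. Qed.

Lemma c2_nonneg : 0 <= c2.
Proof. rewrite <- ln_1. apply ln_le; [lra|]. apply ratio_ge1. lra. Qed.

Lemma K2_le_N : K2 <= N.
Proof.
  unfold K2. pose proof c1_nonneg. pose proof (ln_M_nonneg M M_ge2).
  assert (0 <= (c1 + ln (INR M)) / C); [|lra].
  apply Rmult_le_pos; [lra|left; now apply Rinv_0_lt_compat].
Qed.

Lemma budget_lhs_nonneg : 0 <= (c2 + ln 2 + eta * ln (INR M)) / B'.
Proof.
  pose proof c2_nonneg. pose proof (ln_M_nonneg M M_ge2).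
  assert (0 <= ln 2) by (rewrite <- ln_1; apply ln_le; lra).
  apply Rmult_le_pos; [nra|left; apply Rinv_0_lt_compat, B'_pos].
Qed.

Hypothesis N_pos : 0 < N.

Lemma N_e1_pos : 0 < N / e1.
Proof. apply Rdiv_lt_0_compat; lra. Qed.

Lemma K2_nonneg : 0 <= K2.
Proof. pose proof budget_lhs_nonneg. pose proof N_e1_pos. nra. Qed.

Lemma potential_null q m : null M q -> m = 0%nat \/ In m msgs -> potential (q, m) = 0.
Proof.
  intros H Hm. unfold potential. cbn [fst snd]. rewrite null_tot, null_llr by auto.
  destruct (Nat.eqb_spec m 0); [lra|]. destruct Hm as [Hm|Hm]; [easy|]. rewrite H by auto. lra.
Qed.

(** Since U is at least [- ln M] at every posterior, a restart never costs more than [N]; [K2] is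
    defined to make this exact. *)
Lemma potential_transmit_le q : positive M q -> potential (q, 0%nat) <= N * tot M q.
Proof.
  intros H. unfold potential. cbn [fst snd Nat.eqb].
  pose proof (llr_ge_neg_ent M M_ge2 q H). pose proof (ent_le_lnM M M_ge2 q H).
  replace (N * tot M q) with ((c1 + ln (INR M)) * tot M q / C + K2 * tot M q)
    by (unfold K2; field; lra).
  apply Rplus_le_compat_r, Rmult_le_compat_r; [left; now apply Rinv_0_lt_compat|lra].
Qed.

(** Fano's inequality puts U at entry above [- ln 2 - eta * ln M], and the price term is at most
    [eta * (N / e1)]. *)
Lemma potential_entry_le q m : positive M q -> In m msgs -> (1 - eta) * tot M q <= q m ->
  potential (q, m) <= K2 * tot M q.
Proof.
  intros H Hm Hq. unfold potential. cbn [fst snd].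
  destruct (Nat.eqb_spec m 0) as [->|_]; [apply in_seq in Hm; lia|].
  pose proof (llr_ge_neg_ent M M_ge2 q H) as H1. pose proof (ent_le_fano M M_ge2 q m H Hm) as H2.
  pose proof (tot_pos M M_ge2 q H) as HQ. pose proof (ln_M_nonneg M M_ge2).
  pose proof N_e1_pos as HN. pose proof B'_pos.
  apply Rle_trans with (((c2 + ln 2 + eta * ln (INR M)) / B' + eta * (N / e1)) * tot M q);
    [|apply Rmult_le_compat_r; lra].
  rewrite Rmult_plus_distr_r. apply Rplus_le_compat; [|nra].
  unfold Rdiv. rewrite Rmult_assoc, (Rmult_comm (/ B')), <- Rmult_assoc.
  apply Rmult_le_compat_r; [left; now apply Rinv_0_lt_compat|].
  assert ((tot M q - q m) * ln (INR M) <= eta * tot M q * ln (INR M)); [|lra].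
  apply Rmult_le_compat_r; lra.
Qed.

Lemma odds_of_share q w r : positive M q -> 0 < r -> q w <= (1 - r) * tot M q ->
  q w <= / r * (tot M q - q w).
Proof.
  intros H Hr Hq. pose proof (tot_pos M M_ge2 q H).
  apply Rmult_le_reg_l with r; [easy|]. rewrite <- Rmult_assoc, Rinv_r, Rmult_1_l by lra. nra.
Qed.

(** Without normalisation, [q w] cannot increase, while the mass of the other messages keeps at
    least the fraction [lam]. *)
Lemma odds_step q x a w k : positive M q -> In w msgs -> (forall v, (x v < nx)%nat) ->
  (a < ny)%nat -> (forall z, (z < nx)%nat -> lam <= W z a) -> 0 < k ->
  q w <= k * (tot M q - q w) ->
  step W q x a w <= k / lam * (tot M (step W q x a) - step W q x a w).
Proof.
  intros H Hw Hx Ha HW Hk Hq.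
  assert (L1 : step W q x a w <= q w).
  { unfold step. pose proof (W_le_1 nx ny W lam lam_pos W_dichotomy W_row (x w) a (Hx w) Ha).
    specialize (H w Hw). nra. }
  assert (L2 : lam * (tot M q - q w) <= tot M (step W q x a) - step W q x a w).
  { unfold tot. rewrite <- !(sumL_remove msgs w) by auto using seq_NoDup.
    rewrite <- sumL_scal. apply sumL_le. intros v Hv. destruct (Nat.eq_dec v w); [lra|].
    unfold step. specialize (H v Hv). specialize (HW (x v) (Hx v)). nra. }
  apply Rle_trans with (1 := L1). apply Rle_trans with (1 := Hq).
  apply Rle_trans with (k / lam * (lam * (tot M q - q w))).
  - right. field. lra.
  - apply Rmult_le_compat_l; [|easy]. left. now apply Rdiv_lt_0_compat.
Qed.

(** The factor [/ lam] in the odds bound allows for the overshoot of the last step; this bound keeps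
    [c2 - U] nonnegative up to and including the stopping time. *)
Definition invariant (s : (nat -> R) * nat) : Prop :=
  (snd s = 0%nat \/ In (snd s) msgs /\ (1 - e1) * tot M (fst s) <= fst s (snd s)) /\
  (null M (fst s) \/ positive M (fst s) /\
    (forall w, In w msgs -> fst s w <= / eps / lam * (tot M (fst s) - fst s w)) /\
    (snd s = 0%nat -> forall w, In w msgs -> fst s w <= (1 - eta) * tot M (fst s))).

Definition halted (s : (nat -> R) * nat) : bool :=
  negb (Nat.eqb (snd s) 0) && at_least (1 - eps) (fst s) (snd s).

(** A message other than the one being confirmed has posterior at most [e1 <= / 2 <= 1 - eps]. *)
Lemma share_before_halt s w : invariant s -> halted s = false -> positive M (fst s) ->
  In w msgs -> fst s w <= (1 - eps) * tot M (fst s).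
Proof.
  intros [Hm Hi] Hh Hp Hw. pose proof (tot_pos M M_ge2 _ Hp) as HQ.
  destruct Hi as [Hn|(_ & _ & Hi)].
  { specialize (Hn w Hw). specialize (Hp w Hw). lra. }
  destruct Hm as [Hm|[Hm Hs]].
  - specialize (Hi Hm w Hw). nra.
  - unfold halted in Hh. destruct (Nat.eqb_spec (snd s) 0) as [E|_]; [apply in_seq in Hm; lia|].
    cbn in Hh. assert (Hlt : fst s (snd s) < (1 - eps) * tot M (fst s)).
    { apply Rnot_le_lt. intros Hc. apply at_least_spec in Hc. congruence. }
    destruct (Nat.eq_dec w (snd s)) as [->|Hn]; [lra|].
    assert (L : fst s w <= tot M (fst s) - fst s (snd s)).
    { unfold tot. rewrite <- (sumL_remove msgs (snd s)) by auto using seq_NoDup.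
      pose proof (sumL_ge_term msgs (fun v => if Nat.eq_dec v (snd s) then 0 else fst s v) w) as G.
      cbn beta in G. destruct (Nat.eq_dec w (snd s)); [easy|]. apply G; auto.
      intros v Hv. destruct (Nat.eq_dec v (snd s)); [lra|]. left. auto. }
    nra.
Qed.

Lemma odds_advance s a w : invariant s -> halted s = false -> positive M (fst s) ->
  In w msgs -> (a < ny)%nat -> (forall z, (z < nx)%nat -> lam <= W z a) ->
  fst (advance s a) w <= / eps / lam * (tot M (fst (advance s a)) - fst (advance s a) w).
Proof.
  intros Hi Hh Hp Hw Ha HW. cbn [advance fst]. apply odds_step; auto using encode_lt.
  - now apply Rinv_0_lt_compat.
  - apply odds_of_share; auto. now apply share_before_halt.
Qed.

Lemma advance_dead s a : positive M (fst s) -> (forall x, (x < nx)%nat -> W x a = 0) ->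
  null M (fst (advance s a)).
Proof. intros H HW w Hw. cbn [advance fst]. unfold step. rewrite HW by apply encode_lt. ring. Qed.

Lemma advance_live s a : positive M (fst s) -> (forall x, (x < nx)%nat -> lam <= W x a) ->
  positive M (fst (advance s a)).
Proof.
  intros H HW w Hw. apply Rmult_lt_0_compat; auto. specialize (HW _ (encode_lt s w)). lra.
Qed.

Lemma advance_null s a : null M (fst s) -> null M (fst (advance s a)).
Proof. intros H w Hw. cbn [advance fst]. unfold step. rewrite H by auto. ring. Qed.

Lemma advance_mode s a : invariant s ->
  (snd s <> 0%nat /\ snd (advance s a) = snd s /\
    (1 - e1) * tot M (fst (advance s a)) <= fst (advance s a) (snd s)) \/
  (snd (advance s a) = candidate (fst (advance s a)) /\
    (snd s <> 0%nat -> fst (advance s a) (snd s) <= (1 - e1) * tot M (fst (advance s a)))).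
Proof.
  intros Hi. cbn [advance fst snd].
  destruct (Nat.eqb_spec (snd s) 0) as [E|E]; cbn [negb andb].
  - right. split; [easy|]. congruence.
  - destruct (at_least (1 - e1) _ (snd s)) eqn:E1.
    + left. apply at_least_spec in E1. auto.
    + right. split; [easy|]. intros _. apply Rlt_le, Rnot_le_lt. intros Hc.
      apply at_least_spec in Hc. congruence.
Qed.

Lemma advance_invariant s a : invariant s -> halted s = false -> (a < ny)%nat ->
  invariant (advance s a).
Proof.
  intros Hi Hh Ha.
  assert (Hpos : forall w, In w msgs -> 0 <= fst s w).
  { intros w Hw. destruct Hi as [_ [Hn|[Hp _]]]; [rewrite Hn; auto; lra|left; auto]. }
  assert (HQ : 0 <= tot M (fst (advance s a))).
  { apply sumL_nonneg. intros w Hw. cbn [advance fst]. apply Rmult_le_pos; auto.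
    apply (W_nonneg nx ny W lam); auto using encode_lt. }
  split.
  - destruct (advance_mode s a Hi) as [(Hm & E & Hs)|(E & _)].
    + right. rewrite E. split; auto. destruct Hi as [[Hi|[Hi _]] _]; [easy|auto].
    + rewrite E. destruct (candidate_spec (fst (advance s a))) as [[H _]|[H1 H2]]; [now left|right].
      split; auto. nra.
  - destruct Hi as [Hm [Hn|(Hp & Ho & Hz)]]; [left; now apply advance_null|].
    destruct (W_dichotomy a Ha) as [HW|HW]; [left; now apply advance_dead|right].
    assert (Hi : invariant s) by (split; auto).
    split; [now apply advance_live|]. split; [intros; now apply odds_advance|].
    intros E0 w Hw. destruct (advance_mode s a Hi) as [(Hm' & E & _)|(E & _)].
    + congruence.
    + rewrite E in E0.
      destruct (candidate_spec (fst (advance s a))) as [[_ H]|[H _]]; [left; now apply H|].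
      rewrite E0 in H. apply in_seq in H. lia.
Qed.

Lemma potential_nonneg s : invariant s -> 0 <= potential s.
Proof.
  destruct s as [q m]. intros [Hm [Hn|(Hp & Ho & Hz)]]; cbn [fst snd] in *.
  { rewrite potential_null; [lra|easy|tauto]. }
  pose proof (tot_pos M M_ge2 q Hp) as HQ. unfold potential. cbn [fst snd].
  destruct (Nat.eqb_spec m 0) as [E|E].
  - assert (L : llr M q <= tot M q * c1).
    { apply llr_le; auto.
      - pose proof (ratio_ge1 eta). lra.
      - intros w Hw. pose proof (others_pos M M_ge2 q w Hp Hw).
        apply Rle_trans with (1 := odds_of_share q w eta Hp ltac:(lra) (Hz E w Hw)).
        apply Rmult_le_compat_r; [lra|]. pose proof (inv_ge1 lam (conj lam_pos lam_le1)).
        assert (0 < / eta) by (apply Rinv_0_lt_compat; lra). unfold Rdiv. nra. }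
    pose proof K2_nonneg. apply Rplus_le_le_0_compat; [|nra].
    apply Rmult_le_pos; [lra|left; now apply Rinv_0_lt_compat].
  - destruct Hm as [Hm|[Hm _]]; [easy|].
    assert (L : llr M q <= tot M q * c2).
    { apply llr_le; auto. pose proof (ratio_ge1 eps). lra. }
    pose proof N_e1_pos. pose proof (others_pos M M_ge2 q m Hp Hm).
    apply Rplus_le_le_0_compat; [|nra].
    apply Rmult_le_pos; [lra|left; apply Rinv_0_lt_compat, B'_pos].
Qed.

(** Mode changes never raise the potential, so only the drift of a fixed formula remains to be
    bounded. Entry costs at most [K2], which the transmission formula contains. At a fallback the
    other messages hold at least the share [e1], so the price term is at least [N], enough for
    either new mode. *)
Lemma potential_advance_le s a : invariant s -> halted s = false -> positive M (fst s) ->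
  (a < ny)%nat ->
  let q := fst (advance s a) in
  potential (advance s a) <=
    if Nat.eqb (snd s) 0 then (c1 * tot M q - llr M q) / C + K2 * tot M q
    else (c2 * tot M q - llr M q) / B' + (tot M q - q (snd s)) * (N / e1).
Proof.
  intros Hi Hh Hp Ha q.
  pose proof (advance_invariant s a Hi Hh Ha) as Hi'.
  destruct (W_dichotomy a Ha) as [HW|HW].
  { pose proof (advance_dead s a Hp HW) as Hn. fold q in Hn. rewrite (surjective_pairing (advance s a)).
    fold q. rewrite potential_null; [|easy|destruct Hi' as [[H|[H _]] _]; auto].
    rewrite null_tot, null_llr by easy. destruct (Nat.eqb_spec (snd s) 0); [lra|].
    destruct Hi as [[H|[H _]] _]; [easy|]. rewrite (Hn _ H). lra. }
  pose proof (advance_live s a Hp HW) as Hp'. fold q in Hp'.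
  pose proof (tot_pos M M_ge2 q Hp') as HQ. pose proof B'_pos.
  assert (HiC : 0 < / C) by now apply Rinv_0_lt_compat.
  assert (HiB : 0 < / B') by now apply Rinv_0_lt_compat.
  destruct (Nat.eqb_spec (snd s) 0) as [E|E].
  - assert (L : llr M q <= tot M q * c1).
    { apply llr_le; auto.
      - pose proof (ratio_ge1 eta). lra.
      - intros w Hw. unfold q. cbn [advance fst]. apply odds_step; auto using encode_lt.
        + apply Rinv_0_lt_compat. lra.
        + apply odds_of_share; auto; [lra|].
          destruct Hi as [_ [Hn|(_ & _ & Hz)]]; auto.
          specialize (Hn w Hw). specialize (Hp w Hw). lra. }
    destruct (advance_mode s a Hi) as [(Hm & _)|(Em & _)]; [easy|]. fold q in Em.
    rewrite (surjective_pairing (advance s a)). fold q. rewrite Em.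
    destruct (candidate_spec q) as [[H1 _]|[H1 H2]].
    + rewrite H1. apply Rle_refl.
    + apply Rle_trans with (1 := potential_entry_le q _ Hp' H1 H2).
      assert (0 <= (c1 * tot M q - llr M q) * / C) by (apply Rmult_le_pos; lra).
      unfold Rdiv. lra.
  - destruct (advance_mode s a Hi) as [(_ & Em & _)|(Em & Hs)].
    + rewrite (surjective_pairing (advance s a)). fold q. rewrite Em. unfold potential. cbn [fst snd].
      destruct (Nat.eqb_spec (snd s) 0); [easy|]. apply Rle_refl.
    + specialize (Hs E). fold q in Em, Hs.
      assert (L : llr M q <= tot M q * c2).
      { apply llr_le; auto.
        - pose proof (ratio_ge1 eps). lra.
        - intros w Hw. now apply odds_advance. }
      apply Rle_trans with (N * tot M q).
      * rewrite (surjective_pairing (advance s a)). fold q. rewrite Em.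
        destruct (candidate_spec q) as [[H1 _]|[H1 H2]].
        -- rewrite H1. now apply potential_transmit_le.
        -- apply Rle_trans with (1 := potential_entry_le q _ Hp' H1 H2).
           apply Rmult_le_compat_r; [lra|]. apply K2_le_N.
      * assert (0 <= (c2 * tot M q - llr M q) * / B') by (apply Rmult_le_pos; lra).
        assert (N * tot M q <= (tot M q - q (snd s)) * (N / e1)); [|unfold Rdiv in *; lra].
        replace (N * tot M q) with (e1 * tot M q * (N / e1)) by (field; lra).
        apply Rmult_le_compat_r; [left; apply N_e1_pos|lra].
Qed.

(** Only the term of [m] is kept, the others being nonnegative divergences. All other messages send
    [xr], so the mixture seen by [m] is exactly that row. *)
Lemma confirm_gain q m : positive M q -> In m msgs ->
  q m * B <= sumL msgs (fun w => q w * sumL (seq 0 ny) (fun a =>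
    W (encode (q, m) w) a * ln (W (encode (q, m) w) a /
      mix W msgs (other_weight M q w) (encode (q, m)) a))).
Proof.
  intros H Hm. set (x := encode (q, m)).
  set (F := fun w => q w * sumL (seq 0 ny) (fun a =>
    W (x w) a * ln (W (x w) a / mix W msgs (other_weight M q w) x a))).
  assert (HF : forall w, In w msgs -> 0 <= F w).
  { intros w Hw. apply Rmult_le_pos; [left; auto|].
    apply (div_to_mix_nonneg nx ny W lam); auto; try (intros; apply encode_lt).
    - intros v Hv. now apply other_weight_nonneg.
    - now apply other_weight_sum. }
  apply Rle_trans with (2 := sumL_ge_term msgs F m HF Hm). unfold F. right. f_equal.
  assert (Hm0 : Nat.eqb m 0 = false) by (apply Nat.eqb_neq; apply in_seq in Hm; lia).
  assert (Ex : x m = xc).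
  { unfold x, encode. cbn [fst snd]. rewrite Hm0. now destruct (Nat.eq_dec m m). }
  rewrite <- W_xc_xr, Ex. apply sumL_ext. intros a _. do 3 f_equal. unfold mix.
  rewrite (sumL_ext _ _ (fun v => other_weight M q m v * W xr a)).
  - rewrite sumL_scal_r. change (W xr a = sumL msgs (other_weight M q m) * W xr a).
    rewrite other_weight_sum by auto. lra.
  - intros v _. unfold other_weight, x, encode. cbn [fst snd]. rewrite Hm0.
    destruct (Nat.eq_dec v m); lra.
Qed.

(** The price term has no drift, because [tot q - q m] is preserved in the sum over letters; the
    decrease comes from U, which gains at least [C] or [B'] per step. *)
Lemma potential_drift s : invariant s -> halted s = false ->
  sumL (seq 0 ny) (fun a => potential (advance s a)) + tot M (fst s) <= potential s.
Proof.
  intros Hi Hh. destruct s as [q m]. cbn [fst].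
  pose proof Hi as [Hm [Hn|(Hp & _)]]; cbn [fst snd] in *.
  { rewrite potential_null by tauto. rewrite null_tot by auto. rewrite sumL_zero; [lra|].
    intros a Ha. apply in_seq in Ha.
    pose proof (advance_invariant (q, m) a Hi Hh ltac:(lia)) as [Hm' _].
    rewrite (surjective_pairing (advance (q, m) a)).
    apply potential_null; [now apply advance_null|tauto]. }
  set (x := encode (q, m)).
  assert (Hx : forall w, In w msgs -> (x w < nx)%nat) by (intros; apply encode_lt).
  pose proof (llr_drift nx ny W lam lam_pos W_dichotomy W_row M M_ge2 q x Hp Hx) as D.
  pose proof (sum_tot_step nx ny W W_row M q x Hx) as ST.
  pose proof (tot_pos M M_ge2 q Hp) as HQ. pose proof B'_pos as HB'.
  apply Rle_trans with (sumL (seq 0 ny) (fun a =>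
    let q' := step W q x a in
    if Nat.eqb m 0 then (c1 * tot M q' - llr M q') / C + K2 * tot M q'
    else (c2 * tot M q' - llr M q') / B' + (tot M q' - q' m) * (N / e1)) + tot M q).
  { apply Rplus_le_compat_r, sumL_le. intros a Ha. apply in_seq in Ha.
    apply (potential_advance_le (q, m) a Hi Hh Hp). lia. }
  unfold potential. cbn [fst snd]. cbv zeta.
  destruct (Nat.eqb_spec m 0) as [E|E].
  - rewrite (sumL_ext _ _ (fun a => (c1 / C + K2) * tot M (step W q x a) - / C * llr M (step W q x a)))
      by (intros; unfold Rdiv; ring).
    rewrite sumL_minus, !sumL_scal, ST.
    assert (G : tot M q * C <= sumL (seq 0 ny) (fun a => llr M (step W q x a)) - llr M q).
    { rewrite D. subst m. apply (assign_gain q Hp). }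
    apply Rmult_le_compat_r with (r := / C) in G; [|left; now apply Rinv_0_lt_compat].
    rewrite Rmult_assoc, Rinv_r in G by lra. unfold Rdiv. lra.
  - destruct Hm as [Hm|[Hm Hs]]; [easy|].
    rewrite (sumL_ext _ _ (fun a => ((c2 / B' + N / e1) * tot M (step W q x a) - / B' * llr M (step W q x a))
      - N / e1 * step W q x a m)) by (intros; unfold Rdiv; ring).
    rewrite !sumL_minus, !sumL_scal, ST, (sum_step nx ny W W_row M q x Hx m Hm).
    assert (G : B' * tot M q <= sumL (seq 0 ny) (fun a => llr M (step W q x a)) - llr M q).
    { rewrite D. apply Rle_trans with (2 := confirm_gain q m Hp Hm). unfold B'. nra. }
    apply Rmult_le_compat_l with (r := / B') in G; [|left; now apply Rinv_0_lt_compat].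
    rewrite <- Rmult_assoc, Rinv_l in G by lra. unfold Rdiv. lra.
Qed.

Lemma state_nil_invariant : invariant (state []).
Proof.
  split; [now left|right]. cbn [state fold_left fst snd].
  assert (Hp : positive M (fun _ => / INR M)).
  { intros w _. apply Rinv_0_lt_compat, INR_M_pos. easy. }
  assert (HT : tot M (fun _ => / INR M) = 1).
  { unfold tot. rewrite sumL_const, length_seq. apply Rinv_r.
    pose proof (INR_M_pos M M_ge2). lra. }
  assert (Hs : / INR M <= (1 - eta) * 1).
  { apply Rle_trans with (/ 2); [|lra]. apply Rinv_le_contravar; [lra|].
    apply (le_INR 2). lia. }
  rewrite HT. split; [easy|]. split; [|intros; exact Hs].
  intros w Hw. apply Rle_trans with (/ eps * (1 - / INR M)).
  - pose proof (odds_of_share (fun _ => / INR M) w eps Hp eps_pos) as O. cbn beta in O.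
    rewrite HT in O. apply O. lra.
  - apply Rmult_le_compat_r; [lra|]. pose proof (inv_ge1 lam (conj lam_pos lam_le1)).
    assert (0 < / eps) by now apply Rinv_0_lt_compat. unfold Rdiv. nra.
Qed.

(** Time plus potential is a supermartingale with initial value at most [N]. *)
Lemma scheme_time k :
  stopped_value ny stop_rule (fun y => INR (length y) * mass W M enc y) k [] <= N.
Proof.
  set (P := fun y : list nat => valid y /\ invariant (state y)).
  apply Rle_trans with (INR (length (@nil nat)) * mass W M enc [] + potential (state [])).
  - apply (stopped_value_le ny stop_rule P (fun y => INR (length y) * mass W M enc y)
      (fun y => INR (length y) * mass W M enc y + potential (state y))).
    + intros y a [Hy Hi] Hst Ha. split; [apply Forall_app; auto|].
      rewrite state_snoc. now apply advance_invariant.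
    + intros y [_ Hi]. pose proof (potential_nonneg _ Hi). lra.
    + intros y [_ Hi] Hst. rewrite sumL_plus.
      rewrite (sum_length_mass nx ny W W_row M enc enc_lt).
      pose proof (potential_drift _ Hi Hst) as D.
      rewrite (sumL_ext _ (fun a => potential (state (y ++ [a]))) (fun a => potential (advance (state y) a)))
        by (intros; now rewrite state_snoc).
      unfold mass at 2. rewrite joint_state. lra.
    + split; [constructor|]. apply state_nil_invariant.
  - cbn [length INR]. rewrite Rmult_0_l, Rplus_0_l.
    assert (Hp : positive M (fun _ => / INR M)).
    { intros w _. apply Rinv_0_lt_compat, INR_M_pos. easy. }
    apply Rle_trans with (1 := potential_transmit_le _ Hp). right.
    unfold tot. rewrite sumL_const, length_seq. rewrite Rinv_r; [ring|].
    pose proof (INR_M_pos M M_ge2). lra.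
Qed.

Lemma scheme_is_code :
  is_VLF_code nx ny W M N enc dec stop_rule /\
  exists Pe, Un_cv (fun K => sum_f_R0 (p_err ny W M enc dec stop_rule) K) Pe /\ 0 <= Pe <= eps.
Proof.
  pose proof (mass_additive nx ny W W_row M enc enc_lt) as Hadd.
  pose proof (mass_nonneg nx ny W lam lam_pos W_dichotomy M enc enc_lt) as Hnn.
  destruct (stopping_time_of_bound ny stop_rule (mass W M enc) Hadd Hnn N scheme_time) as [Hcv HN].
  rewrite (mass_nil W M enc M_ge2) in Hcv.
  assert (Etau : forall K, sum_f_R0 (stopped_mass ny stop_rule (mass W M enc)) K =
    sum_f_R0 (p_tau ny W M enc stop_rule) K).
  { intros K. apply sum_eq. intros. symmetry. apply stopped_mass_p_tau. }
  split.
  - split; [lia|]. split; [apply enc_lt|]. split; [apply dec_range|]. split.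
    + intros e He. destruct (Hcv e He) as [K0 HK]. exists K0. intros K HKK.
      rewrite <- Etau. now apply HK.
    + intros K. rewrite <- (HN K). right. apply sum_eq. intros. now rewrite stopped_mass_p_tau.
  - assert (Herr : forall n, 0 <= p_err ny W M enc dec stop_rule n <=
      eps * stopped_mass ny stop_rule (mass W M enc) n).
    { intros n. rewrite (stopped_mass_p_err ny W M enc dec stop_rule n dec_range).
      unfold stopped_mass. rewrite <- sumL_scal. split.
      - apply sumL_nonneg. intros y Hy. apply all_seqs_spec in Hy as [_ Hy].
        destruct (stops_at stop_rule y); [|lra].
        assert (joint W M enc y (dec y) <= mass W M enc y); [|lra].
        apply sumL_ge_term; [intros w _; now apply (joint_nonneg nx ny W lam lam_pos W_dichotomy M enc enc_lt)|].
        apply in_seq. pose proof (dec_range y). lia.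
      - apply sumL_le. intros y Hy. destruct (stops_at stop_rule y) eqn:E; [|lra].
        unfold stops_at in E. apply andb_true_iff in E as [E _].
        unfold stop_rule in E. apply andb_true_iff in E as [E1 E2].
        apply at_least_spec in E2. unfold mass. rewrite joint_state. unfold dec.
        destruct (Nat.eqb (snd (state y)) 0); [discriminate|]. lra. }
    assert (Hgrow : Un_growing (fun K => sum_f_R0 (p_err ny W M enc dec stop_rule) K)).
    { intros K. cbn [sum_f_R0]. pose proof (Herr (S K)). lra. }
    assert (Hub : forall K, sum_f_R0 (p_err ny W M enc dec stop_rule) K <= eps).
    { intros K. apply Rle_trans with (eps * sum_f_R0 (stopped_mass ny stop_rule (mass W M enc)) K).
      - rewrite !sum_f_R0_sumL, <- sumL_scal. apply sumL_le. intros n _. apply Herr.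
      - rewrite stopped_mass_partial_sum by auto. rewrite mass_nil by auto.
        pose proof (alive_mass_nonneg ny stop_rule (mass W M enc) Hnn (S K)). nra. }
    destruct (growing_cv _ Hgrow) as [Pe HPe].
    { exists eps. intros r [K ->]. apply Hub. }
    exists Pe. split; [easy|]. split.
    + apply Rle_trans with (2 := growing_ineq _ _ Hgrow HPe 0%nat). cbn. apply Herr.
    + apply Rnot_lt_le. intros Hlt. destruct (HPe (Pe - eps)) as [K HK]; [lra|].
      specialize (HK K (le_n K)). unfold Rdist in HK. apply Rabs_def2 in HK. specialize (Hub K). lra.
Qed.
End Scheme.

(** * Asymptotics *)

Lemma eventually_and (P Q : R -> Prop) :
  (exists N0, forall N, N >= N0 -> P N) -> (exists N0, forall N, N >= N0 -> Q N) ->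
  exists N0, forall N, N >= N0 -> P N /\ Q N.
Proof.
  intros [N1 H1] [N2 H2]. exists (Rmax N1 N2). intros N HN.
  pose proof (Rmax_l N1 N2). pose proof (Rmax_r N1 N2). split; [apply H1|apply H2]; lra.
Qed.

(** [N * rho N] is [sqrt N] times the diverging [rho N * sqrt N], whereas [ln N <= 2 * sqrt N]. *)
Lemma N_rho_dominates_ln (rho : R -> R) a b c :
  (forall K, exists N0, forall N, N >= N0 -> rho N * sqrt N >= K) -> 0 < a ->
  exists N0, forall N, N >= N0 -> b * ln N + c < a * (N * rho N).
Proof.
  intros Hrho Ha. destruct (Hrho ((2 * Rabs b + Rabs c + 1) / a)) as [N0 HN0].
  exists (Rmax N0 1). intros N HN.
  assert (H0 : N >= N0) by (apply Rle_ge, Rle_trans with (1 := Rmax_l N0 1); lra).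
  assert (H1 : N >= 1) by (apply Rle_ge, Rle_trans with (1 := Rmax_r N0 1); lra).
  specialize (HN0 N H0).
  assert (Hs : 1 <= sqrt N) by (rewrite <- sqrt_1; apply sqrt_le_1; lra).
  assert (Hss : sqrt N * sqrt N = N) by (apply sqrt_sqrt; lra).
  assert (Hl : ln N <= 2 * sqrt N).
  { rewrite <- Hss at 1. rewrite ln_mult by lra. pose proof (ln_le_sub1 (sqrt N)). lra. }
  assert (Hl0 : 0 <= ln N) by (rewrite <- ln_1; apply ln_le; lra).
  assert (HK : 2 * Rabs b + Rabs c + 1 <= a * (rho N * sqrt N)).
  { apply Rge_le in HN0. apply Rmult_le_compat_l with (r := a) in HN0; [|lra].
    replace (a * ((2 * Rabs b + Rabs c + 1) / a)) with (2 * Rabs b + Rabs c + 1) in HN0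
      by (field; lra). lra. }
  assert (E : sqrt N * (a * (rho N * sqrt N)) = a * (sqrt N * sqrt N * rho N)) by ring.
  rewrite Hss in E. rewrite <- E.
  pose proof (Rle_abs b). pose proof (Rle_abs c). pose proof (Rabs_pos b). pose proof (Rabs_pos c).
  apply Rlt_le_trans with (sqrt N * (2 * Rabs b + Rabs c + 1)); [|apply Rmult_le_compat_l; lra].
  assert (b * ln N <= Rabs b * (2 * sqrt N)).
  { apply Rle_trans with (Rabs b * ln N); [now apply Rmult_le_compat_r|].
    now apply Rmult_le_compat_l. }
  assert (Rabs c * 1 <= Rabs c * sqrt N) by (apply Rmult_le_compat_l; lra).
  lra.
Qed.

Lemma nat_within_double r : 0 < r -> exists M, r <= INR M /\ (1 <= r -> INR M <= 2 * r).
Proof.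
  intros Hr. exists (Z.to_nat (up r)). destruct (archimed r) as [H1 H2].
  assert (Hz : (0 <= up r)%Z) by (apply le_IZR; lra).
  rewrite INR_IZR_INZ, Z2Nat.id by easy. split; [lra|]. intros. lra.
Qed.

(** A family needs a code for every positive [N]. Below the range of the scheme, stopping at time
    zero meets any rate, and the error there is unconstrained. *)
Lemma immediate_stop_code nx ny W M N : is_channel nx ny W -> (1 <= M)%nat -> 0 <= N ->
  let f := fun (_ _ : nat) (_ : list nat) => 0%nat in
  is_VLF_code nx ny W M N f (fun _ => 1%nat) (fun _ => true) /\
  exists Pe, Un_cv (fun K => sum_f_R0 (p_err ny W M f (fun _ => 1%nat) (fun _ => true)) K) Pe.
Proof.
  intros HW HM HN f. pose proof (lt_0_INR M ltac:(lia)) as HM'.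
  assert (H0 : forall F K, sum_f_R0 (stopped_mass ny (fun _ => true) F) K = F []).
  { intros F. induction K as [|K IH].
    - cbn. lra.
    - cbn [sum_f_R0]. rewrite IH. unfold stopped_mass. rewrite sumL_zero; [lra|].
      intros y Hy. apply all_seqs_spec in Hy as [Hy _]. destruct y; [discriminate|reflexivity]. }
  assert (Hf : forall n w y, (f n w y < nx)%nat) by (intros; apply HW).
  assert (Hmass : mass W M f [] = 1).
  { unfold mass, tot. rewrite (sumL_ext _ _ (fun _ => / INR M)) by (intros; apply joint_nil).
    rewrite sumL_const, length_seq. field. lra. }
  split.
  - split; [easy|]. split; [easy|]. split; [lia|]. split.
    + intros e He. exists 0%nat. intros K _. unfold Rdist.
      rewrite (sum_eq _ (stopped_mass ny (fun _ => true) (mass W M f))), H0, Hmass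
        by (intros; apply stopped_mass_p_tau).
      rewrite Rminus_diag, Rabs_R0. lra.
    + intros K. rewrite (sum_eq _ (stopped_mass ny (fun _ => true)
        (fun y => INR (length y) * mass W M f y))), H0.
      * cbn. lra.
      * intros n _. now rewrite stopped_mass_p_tau, stopped_mass_length.
  - exists (mass W M f [] - joint W M f [] 1%nat). intros e He. exists 0%nat. intros K _. unfold Rdist.
    rewrite (sum_eq _ (stopped_mass ny (fun _ => true) (fun y => mass W M f y - joint W M f y 1%nat))), H0.
    + rewrite Rminus_diag, Rabs_R0. lra.
    + intros n _. apply (stopped_mass_p_err ny W M f (fun _ => 1%nat)). intros; lia.
Qed.

(** For [u = N * rho N] at one large [N], the bound for a single code reads
    [(E1 / B - / C) * u <= ln N / B] plus a constant, against [ln N = o(u)]. *)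
Lemma converse nx ny W C B lam (rho : R -> R) E :
  0 < lam <= 1 -> 0 < B -> 0 < C ->
  (forall a, (a < ny)%nat ->
    (forall x, (x < nx)%nat -> W x a = 0) \/ (forall x, (x < nx)%nat -> lam <= W x a)) ->
  (forall x, (x < nx)%nat -> sumL (seq 0 ny) (W x) = 1) ->
  (forall x x', (x < nx)%nat -> (x' < nx)%nat ->
    sumL (seq 0 ny) (fun a => W x a * ln (W x a / W x' a)) <= B) ->
  (forall P, is_dist nx P ->
    sumL (seq 0 nx) (fun x => P x * sumL (seq 0 ny) (fun a =>
      W x a * ln (W x a / PY nx W P a))) <= C) ->
  lim_infty rho 0 ->
  (forall N, 0 < N -> 0 < rho N) ->
  (forall K, exists N0, forall N, N >= N0 -> rho N * sqrt N >= K) ->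
  achievable_md nx ny W C rho E -> E <= B / C.
Proof.
  intros Hlam HB HC Hdich Hrow Hdiv Hcap Hrho0 Hrhop Hrho (HE & M & f & g & stop & Pe & Hcode & _ & HPe).
  apply Rnot_lt_le. intros Hlt.
  (* Strictly between [B / C] and [E]: the coefficient of [u] is positive, and the exponent [E1] is
     met for large [N]. *)
  set (E1 := (E + B / C) / 2).
  assert (HBC : 0 < B / C) by now apply Rdiv_lt_0_compat.
  assert (Ha : 0 < E1 / B - / C).
  { apply Rmult_lt_reg_r with B; [easy|].
    replace ((E1 / B - / C) * B) with (E1 - B / C) by (field; lra). unfold E1. lra. }
  assert (HE1 : 0 < E1 /\ 0 < E - E1) by (unfold E1; lra).
  destruct (eventually_and _ _ (HPe (E - E1) (proj2 HE1))
    (eventually_and _ _ (Hrho0 (C / 2) ltac:(lra))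
    (eventually_and _ _ (N_rho_dominates_ln rho E1 1 0 Hrho (proj1 HE1))
    (N_rho_dominates_ln rho (E1 / B - / C) (/ B)
      (3 + (1 - ln (lam * lam)) / B + ln 2 / C) Hrho Ha)))) as [N0 HN0].
  (* With [delta] and [Pe] at most [/ N], the factor [1 - delta - 2 * Pe] is at least [1 - 3 / N],
     nonnegative from 3 on. *)
  set (N := Rmax N0 3).
  assert (L5 : N >= 3) by (apply Rle_ge, Rmax_r).
  destruct (HN0 N (Rle_ge _ _ (Rmax_l N0 3))) as (HN1 & HN2 & HN3 & HN4). clearbody N.
  destruct (Hcode N ltac:(lra)) as ((HM & Hf & Hg & Hcv & Hmean) & HcvE & Hrate).
  replace (E - (E - E1)) with E1 in HN1 by ring.
  rewrite Rminus_0_r in HN2. apply Rabs_def2 in HN2. specialize (Hrhop N ltac:(lra)).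
  set (u := N * rho N) in *.
  assert (HlnM : N * C - u <= ln (INR (M N))).
  { unfold u. apply Rge_le in Hrate. apply Rmult_le_compat_l with (r := N) in Hrate; [|lra].
    replace (N * (ln (INR (M N)) / N)) with (ln (INR (M N))) in Hrate by (field; lra). lra. }
  assert (HlnM0 : 0 < ln (INR (M N))).
  { assert (0 < N * (C - rho N)) by (apply Rmult_lt_0_compat; lra). unfold u in *. lra. }
  assert (HM2 : (2 <= M N)%nat).
  { destruct (Nat.eq_dec (M N) 1) as [E0|]; [|lia]. rewrite E0 in HlnM0; cbn [INR] in HlnM0; rewrite ln_1 in HlnM0. lra. }
  assert (HiN : 0 < / N <= / 2).
  { split; [apply Rinv_0_lt_compat; lra|]. apply Rinv_le_contravar; lra. }
  (* [g0] is the error level [exp (- (E1 * u))], so the penalty costs at most [2 / B], while [kappa]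
     contributes [E1 * u] up to [ln N]. *)
  pose proof (converse_bound nx ny W lam (proj1 Hlam) Hdich Hrow (M N) (f N) Hf HM2 B C
    (proj2 Hlam) HB HC Hdiv Hcap (stop N) (exp (- (E1 * u))) (/ N) (exp_pos _) HiN
    (g N) N (Pe N) Hg Hcv Hmean HcvE) as Bd.
  unfold kappa in Bd. rewrite ln_exp in Bd.
  assert (Hll : 0 < lam * lam) by (apply Rmult_lt_0_compat; lra).
  rewrite (ln_mult (lam * lam)), ln_Rinv in Bd by lra.
  assert (HPeN : Pe N <= / N).
  { apply Rle_trans with (1 := HN1). rewrite <- (exp_ln N) by lra. rewrite <- exp_Ropp.
    destruct (Req_dec (ln N) (E1 * u)) as [->|Hn]; [lra|]. left. apply exp_increasing. lra. }
  assert (H1 : 2 * Pe N / (B * exp (- (E1 * u))) <= 2 / B).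
  { pose proof (exp_pos (- (E1 * u))) as He.
    apply Rle_trans with (2 * exp (- (E1 * u)) / (B * exp (- (E1 * u)))).
    - apply Rmult_le_compat_r; [|lra]. left. apply Rinv_0_lt_compat. now apply Rmult_lt_0_compat.
    - right. field. lra. }
  assert (H2 : N - u / C - 3 <= (1 - / N - 2 * Pe N) * ln (INR (M N)) / C).
  { apply Rle_trans with ((1 - 3 * / N) * (N * C - u) / C).
    - replace ((1 - 3 * / N) * (N * C - u) / C) with (N - u / C - 3 + 3 * rho N / C)
        by (unfold u; field; lra).
      assert (0 < rho N / C) by now apply Rdiv_lt_0_compat. unfold Rdiv in *. lra.
    - apply Rmult_le_compat_r; [left; now apply Rinv_0_lt_compat|].
      assert (H3 : 0 <= 1 - 3 * / N).
      { assert (/ N <= / 3) by (apply Rinv_le_contravar; lra). lra. }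
      apply Rle_trans with ((1 - 3 * / N) * ln (INR (M N))).
      + now apply Rmult_le_compat_l.
      + apply Rmult_le_compat_r; lra. }
  unfold Rdiv in *. lra.
Qed.

(** With [eta = / N] the fallback price [eta * (N / e1)] is the constant [/ e1], at the expense of
    [ln N / C] in the transmission time. *)
Lemma direct_part nx ny W C B lam xc xr Ps N rhoN E e1 :
  0 < lam <= 1 -> 0 < B -> 0 < C -> (0 < nx)%nat ->
  (forall a, (a < ny)%nat ->
    (forall x, (x < nx)%nat -> W x a = 0) \/ (forall x, (x < nx)%nat -> lam <= W x a)) ->
  (forall x, (x < nx)%nat -> sumL (seq 0 ny) (W x) = 1) ->
  (xc < nx)%nat -> (xr < nx)%nat ->
  sumL (seq 0 ny) (fun a => W xc a * ln (W xc a / W xr a)) = B ->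
  is_dist nx Ps ->
  sumL (seq 0 nx) (fun x => Ps x * sumL (seq 0 ny) (fun a =>
    W x a * ln (W x a / PY nx W Ps a))) = C ->
  0 < e1 <= / 2 -> / e1 <= N -> 1 <= N -> 0 < rhoN < C -> 0 <= E ->
  ln N <= E * (N * rhoN) ->
  / C * ln N + ((- ln lam + 2 * ln 2 + C) / ((1 - e1) * B) + / e1 + (- ln lam + ln 2) / C) <=
    (/ C - E / ((1 - e1) * B)) * (N * rhoN) ->
  exists M f g stop Pe, is_VLF_code nx ny W M N f g stop /\
    Un_cv (fun K => sum_f_R0 (p_err ny W M f g stop) K) Pe /\
    ln (INR M) / N >= C - rhoN /\ 0 <= Pe <= exp (- (E * (N * rhoN))).
Proof.
  intros Hlam HB HC Hnx Hdich Hrow Hxc Hxr HBatt [HPs HPs1] HCatt He1 HNe HN1 Hrho HE HlnN Hbud.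
  set (u := N * rhoN) in *.
  destruct (nat_within_double (exp (N * C - u)) (exp_pos _)) as (M & HM1 & HM2).
  assert (HA : 0 < N * C - u).
  { unfold u. assert (0 < N * (C - rhoN)) by (apply Rmult_lt_0_compat; lra). lra. }
  assert (Hexp : 1 + (N * C - u) < exp (N * C - u)) by (apply exp_ineq1; lra).
  specialize (HM2 ltac:(lra)).
  assert (HM : (2 <= M)%nat).
  { apply INR_lt. cbn. lra. }
  assert (HlnM1 : N * C - u <= ln (INR M)).
  { rewrite <- (ln_exp (N * C - u)). apply ln_le; [apply exp_pos|easy]. }
  assert (HlnM2 : ln (INR M) <= ln 2 + (N * C - u)).
  { rewrite <- (ln_exp (N * C - u)), <- ln_mult by (try apply exp_pos; lra).
    apply ln_le; [pose proof (exp_pos (N * C - u)); lra|easy]. }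
  destruct (functional_choice (fun (q : nat -> R) (b : nat -> nat) => (forall w, (b w < nx)%nat) /\
    (positive M q -> tot M q * C <= sumL (seq 1 M) (fun w => q w * sumL (seq 0 ny) (fun a =>
      W (b w) a * ln (W (b w) a / mix W (seq 1 M) (other_weight M q w) b a)))))) as [assign Hassign].
  { intros q. destruct (classic (positive M q)) as [Hq|Hq].
    - destruct (exists_assignment nx Ps Hnx HPs HPs1 ny W lam (proj1 Hlam) Hdich M q HM Hq)
        as (b & Hb & HG).
      exists b. split; [easy|]. intros _. rewrite <- HCatt. exact HG.
    - exists (fun _ => 0%nat). split; [easy|]. contradiction. }
  assert (Hu : 0 < u) by (unfold u; apply Rmult_lt_0_compat; lra).
  set (eps := exp (- (E * u))).
  assert (Heps : eps <= / N).
  { unfold eps. rewrite <- (exp_ln N) by lra. rewrite <- exp_Ropp.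
    destruct (Req_dec (ln N) (E * u)) as [->|Hn]; [lra|]. left. apply exp_increasing. lra. }
  assert (HNe1 : / N <= e1).
  { rewrite <- (Rinv_inv e1). apply Rinv_le_contravar; [apply Rinv_0_lt_compat; lra|easy]. }
  assert (HB' : 0 < (1 - e1) * B) by (apply Rmult_lt_0_compat; lra).
  assert (Hbudget : (c2 lam eps + ln 2 + / N * ln (INR M)) / B' B e1 + / N * (N / e1) <=
                    K2 lam C M N (/ N)).
  { unfold c2, K2, c1, B', eps. rewrite <- exp_Ropp, Ropp_involutive, Rinv_inv.
    rewrite !ln_div, ln_exp by (try apply exp_pos; lra).
    replace (/ N * (N / e1)) with (/ e1) by (field; lra).
    assert (H1 : / N * ln (INR M) <= ln 2 + C).
    { apply Rmult_le_reg_l with N; [lra|]. rewrite <- Rmult_assoc, Rinv_r, Rmult_1_l by lra.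
      assert (0 <= ln 2) by (rewrite <- ln_1; apply ln_le; lra). nra. }
    assert (H2 : (E * u - ln lam + ln 2 + / N * ln (INR M)) / ((1 - e1) * B) <=
                 (E * u - ln lam + 2 * ln 2 + C) / ((1 - e1) * B)).
    { apply Rmult_le_compat_r; [left; now apply Rinv_0_lt_compat|lra]. }
    assert (H3 : (ln N - ln lam + ln (INR M)) / C <= (ln N - ln lam + ln 2 + (N * C - u)) / C).
    { apply Rmult_le_compat_r; [left; now apply Rinv_0_lt_compat|lra]. }
    replace ((ln N - ln lam + ln 2 + (N * C - u)) / C)
      with (/ C * ln N + (- ln lam + ln 2) / C + N - / C * u) in H3 by (field; lra).
    unfold Rdiv in *. lra. }
  destruct (scheme_is_code nx ny W lam B C (proj1 Hlam) (proj2 Hlam) HB HC Hdich Hrow xc xr Hxc Hxr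
    HBatt M HM assign (fun q => proj1 (Hassign q)) (fun q => proj2 (Hassign q))
    N eps (/ N) e1 (exp_pos _) Heps HNe1 (proj2 He1) Hbudget ltac:(lra)) as [Hcode (Pe & HPe & HPe2)].
  do 5 eexists. split; [exact Hcode|]. split; [exact HPe|]. split; [|exact HPe2].
  apply Rle_ge, Rmult_le_reg_l with N; [lra|].
  replace (N * (ln (INR M) / N)) with (ln (INR M)) by (field; lra). unfold u in *. lra.
Qed.

Theorem theorem1 (nx ny : nat) (W : nat -> nat -> R) (C B : R) (rho : R -> R) :
  is_channel nx ny W ->
  (forall P, is_dist nx P -> mutual_info nx ny W P <= C) ->
  (exists Pstar, is_dist nx Pstar /\ mutual_info nx ny W Pstar = C /\
     (forall x, (x < nx)%nat -> 0 < Pstar x)) ->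
  0 < C ->
  (forall x x', (x < nx)%nat -> (x' < nx)%nat -> rel_ent_finite ny W x x') ->
  (forall x x', (x < nx)%nat -> (x' < nx)%nat -> rel_ent ny W x x' <= B) ->
  (exists x x', (x < nx)%nat /\ (x' < nx)%nat /\ rel_ent ny W x x' = B) ->
  (forall N, 0 < N -> 0 < rho N) ->
  lim_infty rho 0 ->
  (forall K, exists N0, forall N, N >= N0 -> rho N * sqrt N >= K) ->
  is_lub (achievable_md nx ny W C rho) (B / C).
Proof.
  intros HW Hcap (Ps & HPs & HCatt & _) HC Hfin Hdiv (xc & xr & Hxc & Hxr & HBatt) Hrhop Hrho0 Hrho.
  destruct (channel_dichotomy nx ny W HW Hfin) as (lam & Hlam & Hdich).
  assert (Hrow : forall x, (x < nx)%nat -> sumL (seq 0 ny) (W x) = 1) by apply HW.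
  assert (Hdiv' : forall x x', (x < nx)%nat -> (x' < nx)%nat ->
    sumL (seq 0 ny) (fun a => W x a * ln (W x a / W x' a)) <= B).
  { intros x x' Hx Hx'. rewrite <- (rel_ent_sum nx) by auto. auto. }
  rewrite (rel_ent_sum nx) in HBatt by auto.
  rewrite mutual_info_sum in HCatt by auto.
  (* [C <= B]: capacity is an average of divergences from rows to a mixture of rows. *)
  assert (HB : 0 < B).
  { apply Rlt_le_trans with (1 := HC). rewrite <- HCatt.
    apply Rle_trans with (sumL (seq 0 nx) (fun x => Ps x * B)).
    - apply sumL_le. intros x Hx. apply in_seq in Hx.
      apply Rmult_le_compat_l; [apply HPs; lia|].
      apply (div_to_mix_le nx ny W lam B (proj1 Hlam) Hdich Hdiv' (seq 0 nx) Ps (fun x => x));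
        try lia; try apply HPs; intros v Hv; apply in_seq in Hv; try apply HPs; lia.
    - rewrite sumL_scal_r. destruct HPs as [_ HPs1]. unfold sumR in HPs1. fold (sumL (seq 0 nx) Ps) in HPs1.
      rewrite HPs1. lra. }
  split.
  - intros E HE. refine (converse nx ny W C B lam rho E Hlam HB HC Hdich Hrow Hdiv' _ Hrho0 Hrhop Hrho HE).
    intros P HP. rewrite <- mutual_info_sum; auto.
  - intros b Hb. apply Rnot_lt_le. intros Hlt.
    assert (HBC : 0 < B / C) by now apply Rdiv_lt_0_compat.
    set (E := (Rmax b 0 + B / C) / 2).
    assert (HE : b < E /\ 0 < E < B / C).
    { unfold E. pose proof (Rmax_l b 0). pose proof (Rmax_r b 0).
      assert (Rmax b 0 < B / C) by (apply Rmax_lub_lt; easy). lra. }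
    clearbody E. destruct HE as [HbE HE].
    enough (Hach : achievable_md nx ny W C rho E) by (specialize (Hb E Hach); lra).
    assert (HEC : 0 < E * C / B < 1).
    { split; [apply Rdiv_lt_0_compat; nra|]. apply Rmult_lt_reg_r with (B / C); [easy|].
      replace (E * C / B * (B / C)) with E by (field; lra). lra. }
    (* Makes [1 - e1] exceed [E * C / B]: per unit of [N * rho N], confirmation then takes less time
       than the [/ C] saved by the reduced rate. *)
    set (e1 := (1 - E * C / B) / 2).
    assert (He1 : 0 < e1 <= / 2) by (unfold e1; lra).
    assert (HB' : 0 < (1 - e1) * B) by (apply Rmult_lt_0_compat; lra).
    assert (Ha : 0 < / C - E / ((1 - e1) * B)).
    { apply Rmult_lt_reg_r with (C * ((1 - e1) * B)); [now apply Rmult_lt_0_compat|].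
      replace ((/ C - E / ((1 - e1) * B)) * (C * ((1 - e1) * B)))
        with (B * (1 - e1 - E * C / B)) by (field; lra).
      rewrite Rmult_0_l. apply Rmult_lt_0_compat; [easy|]. unfold e1. lra. }
    destruct (eventually_and _ _ (N_rho_dominates_ln rho _ (/ C)
        ((- ln lam + 2 * ln 2 + C) / ((1 - e1) * B) + / e1 + (- ln lam + ln 2) / C) Hrho Ha)
      (eventually_and _ _ (N_rho_dominates_ln rho E 1 0 Hrho (proj1 HE)) (Hrho0 C HC)))
      as [N0 HN0].
    set (N1 := Rmax N0 (Rmax 1 (/ e1))).
    assert (HN1 : N1 >= N0 /\ N1 >= 1 /\ N1 >= / e1).
    { pose proof (Rmax_l N0 (Rmax 1 (/ e1))). pose proof (Rmax_r N0 (Rmax 1 (/ e1))).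
      pose proof (Rmax_l 1 (/ e1)). pose proof (Rmax_r 1 (/ e1)). unfold N1. lra. }
    clearbody N1.
    (* The scheme from [N1] on, immediate stopping for smaller positive [N], and dummy data for
       [N <= 0]. *)
    destruct (functional_choice (fun (N : R)
      (t : nat * (nat -> nat -> list nat -> nat) * (list nat -> nat) * (list nat -> bool) * R) =>
      let '(M, f, g, stop, Pe) := t in
      (0 < N -> is_VLF_code nx ny W M N f g stop /\
        Un_cv (fun K => sum_f_R0 (p_err ny W M f g stop) K) Pe /\
        ln (INR M) / N >= C - rho N) /\
      (N >= N1 -> 0 <= Pe <= exp (- (E * (N * rho N)))))) as [code Hcode].
    { intros N. destruct (Rle_lt_dec N1 N) as [HN|HN].
      - destruct (HN0 N ltac:(lra)) as (H1 & H2 & H3). rewrite Rminus_0_r in H3.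
        apply Rabs_def2 in H3. specialize (Hrhop N ltac:(lra)).
        destruct (direct_part nx ny W C B lam xc xr Ps N (rho N) E e1) as (M & f & g & stop & Pe & D);
          auto; try lra.
        + apply HW.
        + exists (M, f, g, stop, Pe). tauto.
      - destruct (Rlt_le_dec 0 N) as [Hp|Hn].
        + destruct (nat_within_double (exp (N * (C - rho N))) (exp_pos _)) as (M & HM & _).
          pose proof (exp_pos (N * (C - rho N))) as Hexp.
          assert (HM1 : (1 <= M)%nat).
          { destruct M; [cbn in HM; lra|lia]. }
          destruct (immediate_stop_code nx ny W M N HW HM1 ltac:(lra)) as [Hc (Pe & HPe)].
          eexists (M, _, _, _, Pe). split; [|lra]. intros _. split; [exact Hc|]. split; [exact HPe|].
          apply ln_le in HM; [|easy]. rewrite ln_exp in HM.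
          apply Rle_ge, Rmult_le_reg_l with N; [easy|].
          replace (N * (ln (INR M) / N)) with (ln (INR M)) by (field; lra). easy.
        + exists (0%nat, fun _ _ _ => 0%nat, fun _ => 0%nat, fun _ => true, 0). split; lra. }
    split; [lra|].
    exists (fun N => fst (fst (fst (fst (code N))))), (fun N => snd (fst (fst (fst (code N))))),
      (fun N => snd (fst (fst (code N)))), (fun N => snd (fst (code N))), (fun N => snd (code N)).
    split; [|split].
    + intros N HN. specialize (Hcode N). destruct (code N) as [[[[M f] g] stop] Pe]. now apply Hcode.
    + intros e He. destruct (N_rho_dominates_ln rho E 0 (- ln e) Hrho (proj1 HE)) as [N2 HN2].
      exists (Rmax N1 N2). intros N HN. pose proof (Rmax_l N1 N2). pose proof (Rmax_r N1 N2).
      specialize (HN2 N ltac:(lra)). specialize (Hcode N).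
      destruct (code N) as [[[[M f] g] stop] Pe]. cbn [snd]. destruct Hcode as [_ Hcode].
      specialize (Hcode ltac:(lra)). rewrite Rminus_0_r, Rabs_pos_eq by lra.
      apply Rle_lt_trans with (1 := proj2 Hcode). rewrite <- (exp_ln e) by easy.
      apply exp_increasing. lra.
    + intros e He. exists N1. intros N HN. specialize (Hcode N).
      destruct (code N) as [[[[M f] g] stop] Pe]. cbn [snd]. destruct Hcode as [_ Hcode].
      specialize (Hcode HN). specialize (Hrhop N ltac:(lra)).
      assert (Hu : 0 < N * rho N) by (apply Rmult_lt_0_compat; lra).
      apply Rle_trans with (1 := proj2 Hcode). left. apply exp_increasing. nra.
Qed.
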